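(* Let $n$ and $m$ be positive integers. The number of rhombus tilings of the hexagon $H(2n,2m)$ with side lengths $2n,2m,2n,2n,2m,2n$ which contain the rhombus above and next to the center of the hexagon (that is, the axis rhombus $\rho_l$ with $l=n+m$) equals \begin{multline*} \frac{n m \binom{2n}{n}\binom{2n-1}{n}\binom{2m}{m}}{\binom{4n+2m-1}{2n+m}} \Biggl(-\frac{1}{(n+m)^2}+\frac{4n+2}{(n+1)(2n-1)(n+m-1)(n+m+1)}\\ \times\sum_{h=0}^{n-1}\frac{(2)_h\,(1-n)_h\,(\frac32+n)_h\,(1-n-m)_h\,(1+n+m)_h}{(1)_h\,(2+n)_h\,(\frac32-n)_h\,(2+n+m)_h\,(2-n-m)_h}\Biggr) \prod_{i=1}^{2n}\prod_{j=1}^{2m}\prod_{k=1}^{2n}\frac{i+j+k-1}{i+j+k-2}. \end{multline*}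
   Context: Shifted factorial: $(a)_0:=1$ and $(a)_k:=a(a+1)\cdots(a+k-1)$ for $k\ge1$. Hexagon: $H(N,M)$ is the hexagon with all angles $120^\circ$ and side lengths, in cyclic order, $N,M,N,N,M,N$, placed with vertices $(0,0)$, $(\pm\frac{\sqrt3}{2}N,\frac N2)$, $(\pm\frac{\sqrt3}{2}N,\frac N2+M)$, $(0,N+M)$ (the sides of length $M$ are vertical). It is subdivided into unit equilateral triangles by the triangular lattice generated by $(0,1)$ and $(\frac{\sqrt3}2,\frac12)$. A rhombus is the union of two unit lattice triangles sharing an edge (side lengths 1, angles $60^\circ$ and $120^\circ$); a rhombus tiling of $H(N,M)$ is a covering of $H(N,M)$ by such rhombi without overlaps. Axis rhombi: for $0\le l\le N+M-1$, $\rho_l$ is the rhombus with vertices $(0,l)$, $(0,l+1)$, $(\pm\frac{\sqrt3}{2},l+\frac12)$; these are the rhombi symmetric about the vertical symmetry axis (of length $N+M$). The center of the hexagon is $(0,\frac{N+M}2)$. *)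

(* Defs.v *)
From HB Require Import structures.
From mathcomp Require Import all_boot all_order all_algebra.

Set Implicit Arguments.
Unset Strict Implicit.
Unset Printing Implicit Defensive.

Import Order.TTheory GRing.Theory Num.Theory.
Local Open Scope ring_scope.

Definition shifted_factorial (a : rat) (k : nat) : rat :=
  \prod_(i < k) (a + i%:R).

(* The pair (a, b) stands for the point a (0, 1) + b (sqrt 3 / 2, 1 / 2) of the
   triangular lattice, whose Cartesian coordinates are
   x = b sqrt 3 / 2 and y = (2 a + b) / 2. *)
Definition point : Type := (int * int)%type.

(* The hexagon H(N, M) with vertices (0, 0), (+- N sqrt 3 / 2, N / 2),
   (+- N sqrt 3 / 2, N / 2 + M), (0, N + M) is the region
   |x| <= N sqrt 3 / 2,  |x| / sqrt 3 <= y <= N + M - |x| / sqrt 3.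
   Here |x| / sqrt 3 = |b| / 2, and the second condition is multiplied by 2. *)
Definition in_hexagon (N M : nat) (p : point) : bool :=
  let: (a, b) := p in
  (`|b| <= N%:Z) && (`|b| <= 2 * a + b <= 2 * (N%:Z + M%:Z) - `|b|).

(* A unit lattice triangle has exactly one vertical side; it is determined by
   the lower end of that side and by the half-plane (right or left of the side)
   in which it lies.  If the triangle is contained in H(N, M), the lower end
   (a, b) satisfies 0 <= a < N + M and - N <= b <= N, so that the triangles
   (a, b + N, is_right) below include all those contained in H(N, M). *)
Definition triangle (N M : nat) : finType :=
  ('I_(N + M)%N * 'I_(2 * N + 1)%N * bool)%type.

Definition vertices (N M : nat) (t : triangle N M) : seq point :=
  let: (i, j, is_right) := t in
  let a := (i : nat)%:Z in
  let b := (j : nat)%:Z - N%:Z in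
  [:: (a, b); (a + 1, b); if is_right then (a, b + 1) else (a + 1, b - 1)].

(* By convexity a triangle is contained in the hexagon iff its vertices are. *)
Definition hexagon (N M : nat) : {set triangle N M} :=
  [set t | all (in_hexagon N M) (vertices t)].

Definition share_edge (N M : nat) (s t : triangle N M) : bool :=
  count (fun p => p \in vertices t) (vertices s) == 2%N.

(* A rhombus is represented by the set of the two triangles it consists of. *)
Definition is_rhombus (N M : nat) (r : {set triangle N M}) : bool :=
  [exists s, exists t, share_edge s t && (r == [set s; t])].

Definition is_tiling (N M : nat) (T : {set {set triangle N M}}) : bool :=
  [forall r in T, is_rhombus r] && partition T (hexagon N M).

(* The rhombus with vertices (0, l), (0, l + 1), (+- sqrt 3 / 2, l + 1 / 2),
   given as the set of the unit triangles with vertices among these points. *)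
Definition axis_rhombus (N M l : nat) : {set triangle N M} :=
  [set t | all (fun p => p \in [:: (l%:Z, 0); (l%:Z + 1, 0);
                                   (l%:Z, 1); (l%:Z + 1, -1)]) (vertices t)].

Definition num_tilings_with_axis_rhombus (N M l : nat) : nat :=
  #|[set T : {set {set triangle N M}} |
      is_tiling T & axis_rhombus N M l \in T]|.

(* Main.v *)
Require Import Defs.
From HB Require Import structures.
From mathcomp Require Import all_boot all_order all_algebra.
From mathcomp Require Import perm zify ring lra.

(* Cut the hexagon along the vertical axis.  A tiling meets the axis in a set S of
   N axis rhombi, and each half of it is a strict Gelfand-Tsetlin pattern with top
   row S, so that there are det (C(x, j)) for x in S and 0 <= j < N choices for
   each half.  The number of tilings containing the rhombus at l is thus the sum
   of the squares of these determinants over all S containing l.  By Andreief's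
   identity and a change of basis to the discrete Legendre polynomials t_k, which
   are orthogonal on {0, ..., N + M - 1}, this sum is the total number of tilings
   times the Christoffel-Darboux kernel sum_(k < N) t_k(l)^2 / |t_k|^2.
   At the point l = (N + M) / 2 the three-term recurrence gives t_k(l) in closed
   form, and the kernel is compared with the hypergeometric sum by induction on n
   with n + m fixed: the difference of the summands for n and n + 1 is a
   telescoping product of two central binomial coefficients. *)

Set Implicit Arguments.
Unset Strict Implicit.
Unset Printing Implicit Defensive.

Import Order.TTheory GRing.Theory Num.Theory.
Local Open Scope ring_scope.

(** * Perfect matchings *)

Section Tilings.
Local Open Scope nat_scope.

Section Matchings.
Variables (V : finType) (e : rel V).
Hypotheses (e_sym : symmetric e) (e_irr : irreflexive e).

(** A tiling is a perfect matching of the adjacency graph of the unit triangles, so every count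
    starts from the choice of a partner for one vertex. Only axis rhombi join the two halves of the
    hexagon; once their positions are fixed the halves are independent, and both become the same
    region in coordinates that start from the outer sides, whence the squares. That exactly N axis
    rhombi occur need not be imposed: a half with any other number of holes has no matching. The
    condition that [l] be hit is handled as a difference, all choices minus those avoiding [l].
    Leaving one point out of the summation changes the diagonal Gram matrix of the Legendre
    polynomials by a matrix of rank one, and this produces the kernel. With P = 2s points the
    symmetry center is (P - 1) / 2, so l = s is half a step off. The polynomials of odd degree
    therefore do not drop out, but the middle coefficient P - 1 - 2s of the recurrence is -1 in
    every degree, and the recurrence collapses to first-order ones. The kernel grows by the two
    degrees 2n and 2n + 1 at a time, which matches one step of the induction on n. *)

Definition is_edge (r : {set V}) : bool :=
  [exists s, exists t, e s t && (r == [set s; t])].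

Definition matchings (X : {set V}) : {set {set {set V}}} :=
  [set T : {set {set V}} | [forall r in T, is_edge r] && partition T X].

Definition num_matchings (X : {set V}) : nat := #|matchings X|.

Lemma is_edge_set2 (s t : V) : e s t -> is_edge [set s; t].
Proof. by move=> est; apply/existsP; exists s; apply/existsP; exists t; rewrite est eqxx. Qed.

Lemma is_edgeP (r : {set V}) (s : V) :
  is_edge r -> s \in r -> exists2 t, e s t & r = [set s; t].
Proof.
case/existsP => a /existsP[b /andP[eab /eqP ->]].
rewrite !inE => /orP[] /eqP ->; first by exists b.
by exists a; [rewrite e_sym | rewrite setUC].
Qed.

Lemma card_matchings_block (X r : {set V}) :
  is_edge r -> r \subset X ->
  #|[set T in matchings X | r \in T]| = num_matchings (X :\: r).
Proof.
move=> er rX.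
have rT (T : {set {set V}}) : T \in matchings (X :\: r) -> r \notin T.
  rewrite inE => /andP[_ pT]; apply/negP => rT.
  have := partitionS pT rT.
  have [s [t [_ ->]]]: exists s t, e s t /\ r = [set s; t].
    by case/existsP: er => s /existsP[t /andP[est /eqP ->]]; exists s, t.
  by move/subsetP/(_ s); rewrite !inE eqxx /= => /(_ isT).
rewrite /num_matchings -[RHS](card_in_imset (f := fun T => r |: T)); last first.
  move=> T T' hT hT' /(congr1 (fun T => T :\ r)).
  by rewrite !setU1K ?rT.
apply: eq_card => T; rewrite !inE; apply/idP/imsetP.
  case/andP => /andP[/forall_inP eT pT] rinT; exists (T :\ r); last by rewrite setD1K.
  rewrite inE partitionD1 // andbT; apply/forall_inP => q.
  by rewrite !inE => /andP[_ /eT].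
case=> T' hT' ->; have := rT _ hT'; move: hT'.
rewrite !inE => /andP[/forall_inP eT pT] rT'; rewrite eqxx andbT.
apply/andP; split.
  by apply/forall_inP => q; rewrite !inE => /orP[/eqP ->|/eT].
have -> : X = r :|: (X :\: r).
  by rewrite -[in LHS](setID X r) (setIidPr rX).
apply: partitionU1 => //; last by rewrite disjoint_sym -setI_eq0 setDE -setIA [~: r :&: r]setIC setICr setI0 eqxx.
by case/existsP: er => s /existsP[t /andP[est /eqP ->]]; apply/set0Pn; exists s; rewrite !inE eqxx.
Qed.

(** The block of a matching that contains [t] is an edge at [t]; sorting the matchings by its other
    end gives the recursion by which all regions are counted. *)
Lemma num_matchings_rec (X : {set V}) (t : V) : t \in X ->
  num_matchings X = \sum_(u in X | e t u) num_matchings (X :\ t :\ u).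
Proof.
move=> tX.
pose N u := [set T in matchings X | [set t; u] \in T].
transitivity (\sum_(u in X | e t u) #|N u|)%N; last first.
  apply: eq_bigr => u /andP[uX etu].
  rewrite card_matchings_block ?is_edge_set2 //; last first.
    by apply/subsetP => v; rewrite !inE => /orP[] /eqP ->.
  by rewrite setDDl.
rewrite /num_matchings -sum1_card.
under [in RHS]eq_bigr => u _ do rewrite -sum1_card big_mkcond /=.
rewrite exchange_big /= big_mkcond /=.
apply: eq_bigr => T _; case: ifP => hT; last first.
  by rewrite big1 // => u _; rewrite inE hT.
move: (hT); rewrite inE => /andP[/forall_inP eT pT].
have tc : t \in cover T by rewrite (cover_partition pT).
have [u etu defu] : exists2 u, e t u & pblock T t = [set t; u].
  by apply: is_edgeP; [apply: eT; apply: pblock_mem | rewrite mem_pblock].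
have uT : [set t; u] \in T by rewrite -defu pblock_mem.
have uX : u \in X.
  by have/subsetP := partitionS pT uT; apply; rewrite !inE eqxx orbT.
rewrite (bigD1 u) /=; last by rewrite uX.
rewrite inE hT uT big1 ?addn0 // => v /andP[/andP[vX etv] nvu].
rewrite inE hT /=; case: ifP => // vT.
have : pblock T t = [set t; v].
  by apply: def_pblock => //; [case/and3P: pT | rewrite !inE eqxx].
rewrite defu => /setP/(_ v); rewrite !inE eqxx orbT (negPf nvu) orbF => /eqP vt.
by rewrite vt e_irr in etv.
Qed.

Lemma num_matchings0 : num_matchings set0 = 1%N.
Proof.
rewrite /num_matchings (_ : matchings set0 = [set set0]) ?cards1 //.
apply/setP => T; rewrite !inE partition_set0 andbC.
by case: eqP => // -> /=; apply/forall_inP => r; rewrite inE.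
Qed.


Lemma num_matchings_forced (X : {set V}) (t u : V) :
  t \in X -> u \in X -> e t u -> {in X, forall v, e t v -> v = u} ->
  num_matchings X = num_matchings (X :\ t :\ u).
Proof.
move=> tX uX etu only; rewrite (num_matchings_rec tX) (bigD1 u) ?uX //=.
rewrite big1 ?addn0 // => v /andP[/andP[vX etv] /eqP nvu].
by case: nvu; apply: only.
Qed.

Lemma num_matchings_isolated (X : {set V}) (t : V) :
  t \in X -> {in X, forall v, ~~ e t v} -> num_matchings X = 0%N.
Proof.
move=> tX iso; rewrite (num_matchings_rec tX) big1 // => v /andP[vX].
by rewrite (negPf (iso v vX)).
Qed.

(** * Matchings of two parts joined along a cut *)

Section Split.
Variable b : V -> V.

Definition crossing (A B : {set V}) : {set V} :=
  [set u in A | (b u \in B) && e u (b u)].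

(* [S] collects the vertices of [A] that are matched with a vertex of [B]. *)
Lemma num_matchings_split (A B : {set V}) :
    [disjoint A & B] -> {in A & B, forall u v, e u v -> v = b u} ->
    {in A &, injective b} ->
  num_matchings (A :|: B) =
  \sum_(S : {set V} | S \subset crossing A B)
     num_matchings (A :\: S) * num_matchings (B :\: b @: S).
Proof.
have [k] := ubnP #|A|; elim: k A B => // k IH A B /ltnSE leAk disAB cross binj.
have [->|[t tA]] := set_0Vmem A.
  rewrite (big_pred1 set0) => [|S]; last first.
    rewrite (_ : crossing _ _ = set0) ?subset0 //.
    by apply/setP => u; rewrite !inE.
  by rewrite imset0 !setD0 set0U num_matchings0 mul1n.
have tB : t \notin B by rewrite (disjointFr disAB).
have step (A' : {set V}) : A' \subset A :\ t -> (#|A'| < k)%N.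
  move=> sA'; apply: leq_ltn_trans (subset_leq_card sA') _.
  by move: leAk; rewrite (cardsD1 t A) tA.
have crossS (A' B' : {set V}) : A' \subset A -> B' \subset B ->
    {in A' & B', forall u v, e u v -> v = b u}.
  by move=> /subsetP sA /subsetP sB u v /sA uA /sB; apply: cross.
have binjS (A' : {set V}) : A' \subset A -> {in A' &, injective b}.
  by move=> /subsetP sA u v /sA uA /sA; apply: binj.
have disS (A' B' : {set V}) : A' \subset A -> B' \subset B -> [disjoint A' & B'].
  by move=> sA sB; apply: disjointWl sA _; apply: disjointWr sB _.
rewrite (@num_matchings_rec _ t) ?inE ?tA //.
(* A partner of [t] inside [A] corresponds to the sets [S] without [t]; the partner [b t]
   corresponds to those containing [t]. *)
rewrite (bigID (fun u => u \in A)) [RHS](bigID (fun S : {set V} => t \in S)) /= addnC.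
congr (_ + _)%N; last first.
  transitivity (\sum_(u in A | e t u) \sum_(S : {set V} | S \subset crossing (A :\ t :\ u) B)
     num_matchings (A :\ t :\ u :\: S) * num_matchings (B :\: b @: S))%N.
    apply: eq_big => u; first by rewrite !inE; case: (u \in A) => /=; rewrite ?andbT ?andbF.
    rewrite !inE => /andP[/andP[_ etu] uA].
    have uB : u \notin B by rewrite (disjointFr disAB).
    have -> : (A :|: B) :\ t :\ u = (A :\ t :\ u) :|: B.
      apply/setP => v; rewrite !inE; have [->|_] := eqVneq v u; first by rewrite (negPf uB).
      by have [->|_] := eqVneq v t; first by rewrite (negPf tB).
    have sA : A :\ t :\ u \subset A by rewrite setDDl subsetDl.
    by apply: IH => //; [apply: step; exact: subsetDl | exact: disS | exact: crossS | exact: binjS].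
  rewrite (exchange_big_dep (fun S : {set V} => (S \subset crossing A B) && (t \notin S))) /=.
    apply: eq_bigr => S /andP[SI tS].
    have SA : S \subset A by apply: subset_trans SI _; apply/subsetP => v; rewrite inE => /andP[].
    rewrite (@num_matchings_rec (A :\: S) t) ?inE ?tA ?tS // big_distrl /=.
    apply: eq_big => [u|u /andP[/andP[uA etu] _]]; last first.
      by congr (num_matchings _ * _)%N; apply/setP => v; rewrite !inE; do !case: (_ \in _); do !case: (_ == _).
    rewrite !inE; case uA: (u \in A); rewrite ?andbF //=.
    case: (e t u); rewrite ?andbF //= ?andbT.
    apply/subsetP/idP => [sub|uS v vS].
      by apply/negP => uS; have := sub u uS; rewrite !inE eqxx.
    move/subsetP: SI => /(_ v vS); rewrite !inE => /andP[-> ->].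
    rewrite !andbT; apply/andP; split; first by apply: contraNneq uS => <-.
    by apply: contraNneq tS => <-.
  move=> u S /andP[uA etu] /subsetP sub; apply/andP; split.
    by apply/subsetP => v /sub; rewrite !inE => /andP[/and3P[_ _ ->] ->].
  by apply/negP => /sub; rewrite !inE eqxx andbF.
case tI : (t \in crossing A B); last first.
  rewrite big1 => [|u]; last first.
    rewrite !inE => /andP[/andP[/orP[->//|uB] etu] _].
    by move: tI; rewrite !inE tA -(cross _ _ tA uB etu) uB etu.
  rewrite big1 // => S /andP[/subsetP/(_ t) sub /sub]; by rewrite tI.
move: (tI); rewrite inE tA /= => /andP[btB etb].
rewrite (big_pred1 (b t)); last first.
  move=> u; rewrite !inE; apply/idP/eqP => [/andP[/andP[/orP[uA|uB] etu] nuA]|->].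
  - by rewrite uA in nuA.
  - exact: cross.
  by rewrite btB orbT etb; apply/negP => btA; rewrite (disjointFr disAB btA) in btB.
have -> : (A :|: B) :\ t :\ b t = (A :\ t) :|: (B :\ b t).
  apply/setP => v; rewrite !inE; have [->|_] := eqVneq v (b t).
    by rewrite (disjointFl disAB btB) ?andbF.
  by have [->|_] := eqVneq v t; first by rewrite (negPf tB).
have sA : A :\ t \subset A by rewrite subsetDl.
have sB : B :\ b t \subset B by rewrite subsetDl.
rewrite IH ?step ?disS //; [| exact: crossS | exact: binjS].
rewrite [RHS](reindex_onto (fun S => t |: S) (fun S => S :\ t)) /=; last first.
  by move=> S /andP[_ tS]; rewrite setD1K.
apply: eq_big => [S|S].
  rewrite !inE eqxx /= andbT; apply/subsetP/andP => [sub|[/subsetP sub /eqP eS] v vS].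
    have tS : t \notin S by apply/negP => /sub; rewrite !inE eqxx.
    split; last by rewrite setU1K.
    apply/subsetP => v; rewrite !inE => /orP[/eqP ->|/sub]; first by rewrite tA btB.
    by rewrite !inE => /andP[/andP[_ ->] /andP[/andP[_ ->] ->]].
  have vt : v != t by apply: contraTneq vS => ->; rewrite -eS !inE eqxx.
  have /sub : v \in t |: S by rewrite !inE vS orbT.
  rewrite !inE vt => /andP[vA /andP[-> ->]]; rewrite vA /= !andbT.
  by apply: contraNneq vt => /binj ->.
move=> _; congr (num_matchings _ * num_matchings _)%N.
  by rewrite setDDl.
by rewrite imsetU1 setDDl.
Qed.
End Split.
End Matchings.

(** Injectivity and preservation of edges are asked on [X] only: the changes of coordinates applied
    below use truncated subtraction and [inord], and are faithful only on the half hexagon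
    concerned. *)
Lemma num_matchings_iso (U V : finType) (eU : rel U) (eV : rel V) (f : U -> V) (X : {set U}) :
    symmetric eU -> irreflexive eU -> symmetric eV -> irreflexive eV ->
    {in X &, injective f} -> {in X &, forall u v, eV (f u) (f v) = eU u v} ->
  num_matchings eV (f @: X) = num_matchings eU X.
Proof.
move=> symU irrU symV irrV; have [k] := ubnP #|X|; elim: k X => // k IH X /ltnSE leXk finj fe.
have [->|[t tX]] := set_0Vmem X; first by rewrite imset0 !num_matchings0.
rewrite (@num_matchings_rec _ eV _ _ _ (f t)) ?imset_f //.
rewrite (@num_matchings_rec _ eU _ _ _ t) //.
rewrite big_mkcondr big_imset //= [RHS]big_mkcondr /=.
apply: eq_bigr => u uX; rewrite fe //; case: ifP => // etu.
have sX : X :\ t :\ u \subset X by rewrite setDDl subsetDl.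
rewrite -IH; first last.
- by move=> v w /(subsetP sX) vX /(subsetP sX) wX; exact: fe.
- by move=> v w /(subsetP sX) vX /(subsetP sX) wX; exact: finj.
- apply: leq_trans leXk; rewrite (cardsD1 t X) tX add1n ltnS.
  by apply: subset_leq_card; exact: subsetDl.
congr num_matchings; apply/setP => v; apply/idP/imsetP => [|[w]]; rewrite !inE.
  case/and3P => vu vt /imsetP[w wX vw]; exists w => //; rewrite !inE wX vw in vu vt *.
  by rewrite andbT; apply/andP; split; [apply: contraNneq vu => ->|apply: contraNneq vt => ->].
case/and3P => wu wt wX ->; rewrite imset_f //.
by rewrite !(inj_in_eq finj) // wu wt.
Qed.

(** * Half hexagons *)

(** The half-open ranges [l <= mu < l'] make the new row strictly increasing by themselves, so no
    relation between different [mu] has to be stated. *)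
Fixpoint interlacing_sum (l : nat) (ls : seq nat) (f : seq nat -> nat) : nat :=
  if ls is l' :: ls' then
    \sum_(l <= mu < l') interlacing_sum l' ls' (fun c => f (mu :: c))
  else f [::].

(* The number of strict Gelfand-Tsetlin patterns with top row [L]; it vanishes
   unless [L] has size [k]. *)
Fixpoint num_interlacing (k : nat) (L : seq nat) : nat :=
  match k, L with
  | 0, _ => L == [::]
  | k'.+1, [::] => 0
  | k'.+1, l :: ls => interlacing_sum l ls (num_interlacing k')
  end.

Lemma eq_interlacing_sum l ls f g : f =1 g ->
  interlacing_sum l ls f = interlacing_sum l ls g.
Proof.
elim: ls l f g => //= l' ls IH l f g fg.
by apply: eq_bigr => mu _; apply: IH => c; apply: fg.
Qed.

Lemma interlacing_sum0 l ls f : f =1 (fun=> 0) -> interlacing_sum l ls f = 0.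
Proof.
elim: ls l f => //= l' ls IH l f f0.
by rewrite big1 // => mu _; apply: IH => c; apply: f0.
Qed.

(* Common coordinates [(k, x, b)] for the two halves of the hexagon.  Level [k]
   consists of the triangles between the vertical lattice lines at distance
   [N - k] and [N - k + 1] from the axis; [x] counts from the bottom, and [b]
   tells whether the vertical side of the triangle lies on the line closer to
   the axis. *)
Definition half_adj (u v : nat * nat * bool) : bool :=
  let: (k, x, b) := u in let: (k', x', b') := v in
  match b, b' with
  | true, false => (k == k') && ((x == x') || (x == x'.+1)) || (k' == k.+1) && (x' == x)
  | false, true => (k' == k) && ((x' == x) || (x' == x.+1)) || (k == k'.+1) && (x == x')
  | _, _ => false
  end.

(** * Peeling a half hexagon strip by strip *)

Section Half.
Variables (M Bd : nat).

Definition half_vertex : finType := ('I_Bd.+1 * 'I_Bd.+1 * bool)%type.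

Definition code (u : half_vertex) : nat * nat * bool :=
  (nat_of_ord u.1.1, nat_of_ord u.1.2, u.2).

Definition half_edge : rel half_vertex := fun u v => half_adj (code u) (code v).

Lemma half_edge_sym : symmetric half_edge.
Proof. by move=> [[k x] []] [[k' x'] []]. Qed.

Lemma half_edge_irr : irreflexive half_edge.
Proof. by move=> [[k x] []]. Qed.

(* All levels below [k], without the triangles at the positions in [c] that are
   adjacent to level [k], and the part of level [k] from the positions [yo] and
   [yi] on, without the triangles at the positions in [d] facing the axis. *)
Definition region_pred (k yo yi : nat) (c d : seq nat) (u : nat * nat * bool) : bool :=
  let: (j, x, b) := u in
  if j == k then
    (if b then (yo <= x < M + k) && (x \notin d) else (yi <= x) && (x.+1 < M + k))
  else (0 < j < k) &&
    (if b then (x < M + j) && ~~ ((j.+1 == k) && (x \in c)) else x.+1 < M + j).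

Definition region (k yo yi : nat) (c d : seq nat) : {set half_vertex} :=
  [set u | region_pred k yo yi c d (code u)].

Definition half_region (k : nat) (d : seq nat) : {set half_vertex} :=
  region k 0 0 [::] d.

Local Notation pm := (num_matchings half_edge).

Lemma code_inj : injective code.
Proof.
move=> [[k x] b] [[k' x'] b'] [] /= /eqP ek /eqP ex ->.
by congr (_, _, _); apply/eqP.
Qed.

Lemma codeP (k x : nat) (b : bool) : k <= Bd -> x <= Bd -> exists u, code u = (k, x, b).
Proof.
by move=> hk hx; exists (inord k, inord x, b); rewrite /code /= !inordK.
Qed.

Lemma regionP k yo yi c d u :
  (u \in region k yo yi c d) = region_pred k yo yi c d (code u).
Proof. by rewrite inE. Qed.

Lemma region_hole k y yi c d : y \in d -> region k y yi c d = region k y.+1 yi c d.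
Proof.
move=> yd; apply/setP => u; rewrite !regionP /region_pred.
case: (code u) => [[j x] b]; case: eqP => // _; case: b => //.
by have [->|] := eqVneq x y; [rewrite yd !andbF | case: (x \in d) => /=; lia].
Qed.

(** The lowest triangle facing the axis has lost its neighbor below, and the strip nearer to the
    axis is absent, so one neighbor remains. At the top of the strip even this one is missing, which
    is the next lemma. *)
Lemma region_forced k y c d : k <= Bd -> M + k <= Bd -> y.+1 < M + k -> 0 < k ->
  y \notin d -> pm (region k y y c d) = pm (region k y.+1 y.+1 c d).
Proof.
move=> hk hM hy k0 yd.
have [t ct] := @codeP k y true hk ltac:(lia).
have [u cu] := @codeP k y false hk ltac:(lia).
rewrite (num_matchings_forced half_edge_sym half_edge_irr (t := t) (u := u)).
- congr num_matchings; apply/setP => v; rewrite !inE -!(inj_eq code_inj) ct cu /region_pred.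
  case: (code v) => [[j x] b]; rewrite !xpair_eqE.
  by case: (eqVneq j k) => [_|nj]; case: b => /=; lia.
- by rewrite regionP ct /region_pred eqxx yd; lia.
- by rewrite regionP cu /region_pred eqxx; lia.
- by rewrite /half_edge ct cu /= !eqxx.
move=> v; rewrite regionP /half_edge ct => + adj; move: adj.
move=> adj hv; apply: code_inj; rewrite cu; move: adj hv; rewrite /region_pred.
case: (code v) => [[j x] []] //=; case: (eqVneq j k) => [->|/eqP njk] /= adj hv.
  by congr (_, _, _); lia.
by exfalso; lia.
Qed.

Lemma region_isolated k y c d : k <= Bd -> M + k <= Bd -> y.+1 = M + k -> 0 < k ->
  y \notin d -> pm (region k y y c d) = 0.
Proof.
move=> hk hM hy k0 yd.
have [t ct] := @codeP k y true hk ltac:(lia).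
apply: (num_matchings_isolated half_edge_sym half_edge_irr (t := t)).
  by rewrite regionP ct /region_pred eqxx yd; lia.
move=> v; rewrite regionP /half_edge ct /region_pred.
case: (code v) => [[j x] []] //=; case: (eqVneq j k) => [->|/eqP njk] /= hv; lia.
Qed.

(** The inner triangle at [y] no longer has its neighbor at [y] in the same strip. Either it takes
    the one at [y.+1], or it crosses to the next level, where [y] becomes a hole. *)
Lemma region_branch k y c d : k < Bd -> M + k.+1 <= Bd -> y < M + k -> y \notin c ->
  pm (region k.+1 y.+1 y c d) =
    (if y.+1 \in d then 0 else pm (region k.+1 y.+2 y.+1 c d)) +
    (if 0 < k then pm (region k.+1 y.+1 y.+1 (rcons c y) d) else 0).
Proof.
move=> hk hM hy yc.
have [t ct] := @codeP k.+1 y false hk ltac:(lia).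
have [u cu] := @codeP k.+1 y.+1 true hk ltac:(lia).
have [v cv] := @codeP k y true ltac:(lia) ltac:(lia).
have tX : t \in region k.+1 y.+1 y c d by rewrite regionP ct /region_pred eqxx; lia.
rewrite (num_matchings_rec half_edge_sym half_edge_irr tX).
have uv : u != v by rewrite -(inj_eq code_inj) cu cv !xpair_eqE; lia.
rewrite (bigID (fun w => w == u)) /=; congr (_ + _).
  transitivity (\sum_(w | (w == u) && (y.+1 \notin d))
     pm (region k.+1 y.+2 y.+1 c d)); last first.
    case: (y.+1 \in d); first by rewrite big_pred0 // => w; rewrite andbF.
    by rewrite (big_pred1 u) // => w; rewrite andbT.
  apply: eq_big => w.
    case: (eqVneq w u) => [->|]; rewrite ?andbF // andbT /=.
    rewrite regionP cu /half_edge ct cu /region_pred eqxx /= !eqxx orbT /=.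
    by case: (y.+1 \in d) => /=; lia.
  move=> /andP[_ /eqP ->]; congr num_matchings.
  apply/setP => z; rewrite !inE -!(inj_eq code_inj) ct cu /region_pred.
  case: (code z) => [[j x] b]; rewrite !xpair_eqE.
  by case: (eqVneq j k.+1) => [_|nj]; case: b => /=; lia.
transitivity (\sum_(w | (w == v) && (0 < k))
     pm (region k.+1 y.+1 y.+1 (rcons c y) d)); last first.
  case: (0 < k); last by rewrite big_pred0 // => w; rewrite andbF.
  by rewrite (big_pred1 v) // => w; rewrite andbT.
apply: eq_big => w.
  rewrite regionP /half_edge ct -!(inj_eq code_inj) cu cv /region_pred.
  case: (code w) => [[j x] []]; rewrite !xpair_eqE ?andbF //=.
  case: (eqVneq x y) => [->|]; rewrite ?(negPf yc) ?andbF ?andbT; last first.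
    by have [?|?] := eqVneq j k.+1; lia.
  by have [?|?] := eqVneq j k.+1; lia.
move=> /andP[/andP[wX tw] wu].
have {wX tw wu} -> : w = v.
  apply: code_inj; move: wX tw wu; rewrite cv.
  rewrite regionP /half_edge ct -!(inj_eq code_inj) cu /region_pred.
  case: (code w) => [[j x] []]; rewrite !xpair_eqE ?andbF //=.
  by case: (eqVneq j k.+1) => [->|] /= *; congr (_, _, _); lia.
congr num_matchings.
apply/setP => z; rewrite !inE -!(inj_eq code_inj) ct cv /region_pred.
case: (code z) => [[j x] b]; rewrite mem_rcons inE !xpair_eqE.
case: (eqVneq j k.+1) => [->|njk].
  by case: b; rewrite ?andbF //=; lia.
case: b; rewrite ?andbF ?andbT //=.
case: (eqVneq j k) => [->|nj] /=; rewrite ?eqSS ?(negPf nj) ?eqxx //=.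
by rewrite negb_or; case: (x \in c); rewrite /= ?andbF //; lia.
Qed.

Lemma region_next k c d :
  region k.+1 (M + k.+1) (M + k) c d = if k is 0 then set0 else half_region k c.
Proof.
apply/setP => u; case: k => [|k]; rewrite !inE /region_pred;
  case: (code u) => [[j x] b]; first by have [?|?] := eqVneq j 1; case: b; lia.
rewrite in_nil andbF !eqSS.
by have [?|?] := eqVneq j k.+2; have [?|?] := eqVneq j k.+1; case: b; lia.
Qed.

(** At [k = 0] there is no level left that could carry holes, so their absence is recorded
    explicitly. *)
Definition half_count (k : nat) (c : seq nat) : nat :=
  if k is 0 then c == [::] else pm (half_region k c).

Lemma half_count_next k c d : (k = 0 -> c = [::]) ->
  pm (region k.+1 (M + k.+1) (M + k) c d) = half_count k c.
Proof.
rewrite region_next; case: k => [|k] //= -> //.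
by rewrite num_matchings0.
Qed.

(* The strip of level [k.+1] is matched from the bottom upwards.  In the first
   claim the boundary position [y] is a hole, and one of the inner triangles
   below the next hole has to be matched with the next level; in the second
   claim nothing is left to be matched with the next level before a hole. *)
Lemma region_interlacing k : k < Bd -> M + k.+1 <= Bd ->
  forall r y c d, y + r = M + k -> all (ltn^~ y) c -> (k = 0 -> c = [::]) ->
    all (ltn^~ (M + k.+1)) d ->
  (path ltn y d -> pm (region k.+1 y.+1 y c d) =
     interlacing_sum y d (fun c' => half_count k (c ++ c'))) /\
  (sorted ltn d -> all (leq y) d -> pm (region k.+1 y y c d) =
     if d is l :: d' then interlacing_sum l d' (fun c' => half_count k (c ++ c'))
     else 0).
Proof.
move=> hk hM; elim=> [|r IH] y c d yr cy c0 dM.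
  have PA : path ltn y d -> pm (region k.+1 y.+1 y c d) =
      interlacing_sum y d (fun c' => half_count k (c ++ c')).
    case: d dM => [|l d] /=; last by move=> /andP[/= ? _] /andP[? _]; lia.
    move=> _ _; rewrite cats0 -(half_count_next [::] c0); congr (pm (region _ _ _ _ _)); lia.
  split=> // sd yd; have [yind|ynd] := boolP (y \in d).
    rewrite region_hole //.
    case: d yind yd sd dM {PA} => // l d.
    rewrite inE /= => yl /andP[yl' yd] sd /andP[lM dM].
    have {yl} yl : l = y by lia.
    case: d sd yd dM => [|l' d] /=; last by move=> /andP[? _] _ /andP[? _]; lia.
    rewrite yl cats0 -(half_count_next [:: y] c0) => _ _ _.
    by congr (pm (region _ _ _ _ _)); lia.
  rewrite region_isolated //; try lia.
  case: d yd dM ynd {PA sd} => // l d /= /andP[? _] /andP[? _]; rewrite inE => ?; lia.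
have cy' : all (ltn^~ y.+1) c by apply: sub_all cy => z /=; lia.
have ycn : y \notin c by apply/negP => /(allP cy) /=; lia.
have cyy : all (ltn^~ y.+1) (rcons c y) by rewrite all_rcons cy' andbT /=.
have yr' : y.+1 + r = M + k by lia.
have PA d' : all (ltn^~ (M + k.+1)) d' -> path ltn y d' -> pm (region k.+1 y.+1 y c d') =
    interlacing_sum y d' (fun c' => half_count k (c ++ c')).
  move=> dM' yd; rewrite region_branch //; last lia.
  (* Without a lower level crossing is impossible; correspondingly, every row extended by some [mu]
     is nonempty and has count 0. *)
  have [kpos|] := ltnP 0 k; last first.
    rewrite leqn0 => /eqP k0; rewrite addn0.
    case: ifP => [yind|/negbT ynd]; last first.
      have [E _] := IH y.+1 c d' yr' cy' c0 dM'; rewrite E {E} //.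
        case: d' yd ynd {dM'} => [|l d'] //= /andP[yl pl].
        rewrite inE negb_or => /andP[nyl _].
        rewrite [RHS]big_ltn //; rewrite interlacing_sum0 ?add0n // => c'.
        by rewrite k0 /=; case: (c).
      case: d' yd ynd {dM'} => [|l d'] //= /andP[yl ->].
      by rewrite inE negb_or => /andP[nyl _]; rewrite andbT; lia.
    case: d' yd yind {dM'} => [|l d'] //= /andP[yl pl] _.
    rewrite big1 // => mu _; apply: interlacing_sum0 => c'.
    by rewrite k0; case: (c).
  have c0' : k = 0 -> rcons c y = [::] by lia.
  have sd' : sorted ltn d' by exact: path_sorted yd.
  have yd' : all (leq y.+1) d' by apply: order_path_min yd; exact: ltn_trans.
  have [_ ->] // := IH y.+1 (rcons c y) d' yr' cyy c0' dM'.
  case: d' yd sd' yd' dM' => [|l d'] /=.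
    by move=> _ _ _ _; have [E _] := IH y.+1 c [::] yr' cy' c0 isT; rewrite E {E} //= addn0.
  move=> /andP[yl pl] _ _ dM'; rewrite inE.
  have -> : interlacing_sum l d' (fun c' => half_count k (rcons c y ++ c')) =
            interlacing_sum l d' (fun c' => half_count k (c ++ y :: c')).
    by apply: eq_interlacing_sum => c'; rewrite cat_rcons.
  (* The term [mu = y] is the branch that crosses at [y]; the terms with larger [mu] form the count
     that starts at [y.+1]. *)
  rewrite [RHS]big_ltn // addnC; congr (_ + _).
  have [yl'|nyl] := eqVneq y.+1 l; first by rewrite /= big_geq // yl'.
  case: ifP => [/= yind|ynd].
    by have := order_path_min ltn_trans pl => /allP/(_ _ yind) /=; lia.
  have [E _] := IH y.+1 c (l :: d') yr' cy' c0 dM'; rewrite E {E} //.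
  by rewrite /= pl andbT; lia.
split=> [|sd yd]; first exact: PA.
case: d dM sd yd => [|l d].
  move=> _ _ _; rewrite region_forced //; try lia.
  by have [_ -> //] := IH y.+1 c [::] yr' cy' c0 isT.
move=> dM sd yd; move: (yd) => /= /andP[yl yd'].
have [eyl|nyl] := eqVneq y l.
  rewrite region_hole ?eyl ?inE ?eqxx // -eyl.
  rewrite -PA; last by move: sd; rewrite /= eyl.
    congr num_matchings; apply/setP => u; rewrite !regionP /region_pred.
    case: (code u) => [[j x] []] //; case: (j == k.+1) => //.
    rewrite inE; have [->|_] := eqVneq x l; rewrite //=; lia.
  by case/andP: dM.
have yn : y \notin l :: d.
  rewrite inE negb_or nyl /=; apply/negP => yind.
  have := order_path_min ltn_trans sd => /allP/(_ _ yind) /=; lia.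
rewrite region_forced //; try lia.
have [_ -> //] := IH y.+1 c (l :: d) yr' cy' c0 dM.
apply/allP => z zd; have := allP yd _ zd.
by rewrite leq_eqVlt => /orP[/eqP e|//]; rewrite e zd in yn.
Qed.

Lemma eq_interlacing_sum_in l ls f g : path ltn l ls ->
    (forall c, sorted ltn c -> all (leq l) c -> all (ltn^~ (last l ls)) c -> f c = g c) ->
  interlacing_sum l ls f = interlacing_sum l ls g.
Proof.
elim: ls l f g => [|l' ls IH] l f g /=; first by move=> _; apply.
case/andP=> ll' pl fg; rewrite big_nat_cond [RHS]big_nat_cond.
apply: eq_bigr => mu /andP[/andP[lmu mul'] _]; apply: IH => // c sc cl' cu.
have ltl : l' <= last l' ls.
  by have /= := mem_last l' ls; rewrite inE => /orP[/eqP ->//|/(allP (order_path_min ltn_trans pl))]; exact: ltnW.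
apply: fg => /=.
- case: c sc cl' {cu} => //= z c -> /andP[? _]; rewrite andbT; lia.
- by rewrite lmu; apply: sub_all cl' => z; lia.
by rewrite cu andbT; lia.
Qed.

Lemma half_region_count k d : k <= Bd -> M + k <= Bd -> sorted ltn d ->
  all (ltn^~ (M + k)) d -> half_count k d = num_interlacing k d.
Proof.
elim: k d => [|k IH] d hk hM sd dM //.
have [_ H] := @region_interlacing k hk hM (M + k) 0 [::] d erefl isT (fun=> erefl) dM.
rewrite /half_count /half_region H //; last by apply/allP.
case: d sd dM {H} => [|l d] // pl dM.
apply: eq_interlacing_sum_in => // c sc cl cu; apply: IH => //; try lia.
apply: sub_all cu => z /= zl.
have /(allP dM) : last l d \in l :: d by exact: mem_last.
by rewrite /= addnS ltnS; lia.
Qed.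
End Half.

(** * Cutting the hexagon along its axis *)

Lemma mem_half_region M Bd k d (u : half_vertex Bd) : 0 < k ->
  (u \in half_region M Bd k d) =
  let: (j, x, b) := code u in
  (0 < j <= k) && (if b then (x < M + j) && ((j < k) || (x \notin d)) else x.+1 < M + j).
Proof.
rewrite regionP /region_pred; case: (code u) => [[j x] b] k0; rewrite in_nil andbF.
by have [->|?] := eqVneq j k; case: b; lia.
Qed.

Lemma half_countE M Bd k c : 0 < k ->
  half_count M Bd k c = num_matchings (@half_edge Bd) (half_region M Bd k c).
Proof. by case: k. Qed.

Section Geometry.
Variables N M : nat.

Definition tcode (t : triangle N M) : nat * nat * bool :=
  (nat_of_ord t.1.1, nat_of_ord t.1.2, t.2).

Lemma tcode_inj : injective tcode.
Proof.
move=> [[k x] b] [[k' x'] b'] [] /= /eqP ek /eqP ex ->.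
by congr (_, _, _); apply/eqP.
Qed.

Lemma tcodeP (i j : nat) (b : bool) : i < N + M -> j < 2 * N + 1 ->
  exists t, tcode t = (i, j, b).
Proof. by move=> hi hj; exists (Ordinal hi, Ordinal hj, b). Qed.

Definition triangle_adj (u v : nat * nat * bool) : bool :=
  let: (i, j, b) := u in let: (i', j', b') := v in
  match b, b' with
  | true, false => (i == i') && (j == j') || (j' == j.+1) && ((i == i') || (i == i'.+1))
  | false, true => (i == i') && (j == j') || (j == j'.+1) && ((i == i') || (i' == i.+1))
  | _, _ => false
  end.

Definition vertex_offsets (b : bool) : seq point :=
  [:: (0, 0); (1, 0); if b then (0, 1) else (1, -1)]%R.

Lemma verticesE (t : triangle N M) : vertices t =
  [seq ((nat_of_ord t.1.1)%:Z + o.1, (nat_of_ord t.1.2)%:Z - N%:Z + o.2)%R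
     | o <- vertex_offsets t.2].
Proof. by case: t => [[i j] []]; rewrite /= !addr0. Qed.

Lemma triangle_adjE i j b i' j' b' : triangle_adj (i, j, b) (i', j', b') =
  (let D := i%:Z - i'%:Z in let F := j%:Z - j'%:Z in
  match b, b' with
  | true, false => (D == 0) && (F == 0) || (F == -1) && ((D == 0) || (D == 1))
  | false, true => (D == 0) && (F == 0) || (F == 1) && ((D == 0) || (D == -1))
  | _, _ => false
  end)%R.
Proof. by rewrite /triangle_adj; case: b; case: b' => //=; lia. Qed.

Lemma share_edgeE (s t : triangle N M) :
  share_edge s t = triangle_adj (tcode s) (tcode t).
Proof.
rewrite /share_edge !verticesE count_map /tcode triangle_adjE.
move: (nat_of_ord s.1.1) (nat_of_ord s.1.2) s.2 => i j b.
move: (nat_of_ord t.1.1) (nat_of_ord t.1.2) t.2 => i' j' b'.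
transitivity (count (fun o => has (fun o' => (i%:Z - i'%:Z == o'.1 - o.1)%R &&
    (j%:Z - j'%:Z == o'.2 - o.2)%R) (vertex_offsets b')) (vertex_offsets b) == 2).
  congr (_ == _); apply: eq_count => o /=.
  by rewrite !inE !xpair_eqE /= orbF; do ?congr (_ || _); lia.
(* Only the relative position [(D, F)] matters, and outside a small box no vertex is shared, so a
   finite case analysis on the two integers suffices. *)
move: (i%:Z - i'%:Z)%R (j%:Z - j'%:Z)%R => D F {i j i' j'}.
by case: b; case: b'; case: D => [[|[|D]]|[|D]]; case: F => [[|[|[|F]]]|[|[|F]]].
Qed.

Lemma share_edge_sym : symmetric (@share_edge N M).
Proof.
move=> s t; rewrite !share_edgeE.
case: (tcode s) (tcode t) => [[i j] []] [[i' j'] []] //=; lia.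
Qed.

Lemma share_edge_irr : irreflexive (@share_edge N M).
Proof. by move=> s; rewrite share_edgeE; case: (tcode s) => [[i j] []]. Qed.

Lemma mem_hexagon (t : triangle N M) : (t \in hexagon N M) =
  let: (i, j, b) := tcode t in
  if b then (j < N) && (N <= i + j) || (N <= j < 2 * N) && (i + j < 2 * N + M)
  else (0 < j <= N) && (N <= i + j) || (N < j) && (i + j < 2 * N + M).
Proof.
case: t => [[i j] b]; rewrite inE /tcode /in_hexagon /=.
have := ltn_ord i; have := ltn_ord j.
move: (nat_of_ord i) (nat_of_ord j) => {i j} i j hj hi.
by case: b => /=; lia.
Qed.

Lemma mem_axis_rhombus (l : nat) (t : triangle N M) :
  (t \in axis_rhombus N M l) =
  let: (i, j, b) := tcode t in (i == l) && (j == N).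
Proof.
case: t => [[i j] b]; rewrite inE /tcode /= !inE.
move: (nat_of_ord i) (nat_of_ord j) => {i j} i j.
by case: b => /=; rewrite !xpair_eqE; lia.
Qed.

Local Notation Bd := (2 * N + M).
Local Notation pm := (num_matchings (@share_edge N M)).

Definition to_half (g : nat * nat * bool -> nat * nat * bool) (t : triangle N M) :
  half_vertex Bd := let: (k, x, b) := g (tcode t) in (inord k, inord x, b).

Lemma num_matchings_to_half g (X : {set triangle N M}) (Y : {set half_vertex Bd}) :
    {in X, forall t, (g (tcode t)).1.1 <= Bd /\ (g (tcode t)).1.2 <= Bd} ->
    {in X &, forall s t, g (tcode s) = g (tcode t) -> tcode s = tcode t} ->
    {in X &, forall s t, half_adj (g (tcode s)) (g (tcode t)) =
                         triangle_adj (tcode s) (tcode t)} ->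
    {in X, forall t v, code v = g (tcode t) -> v \in Y} ->
    {in Y, forall v, exists2 t, t \in X & code v = g (tcode t)} ->
  pm X = num_matchings (@half_edge Bd) Y.
Proof.
move=> bnd inj adj toY fromY.
have cE t : t \in X -> code (to_half g t) = g (tcode t).
  move=> /bnd; rewrite /to_half; case: (g (tcode t)) => [[k x] b] /= [hk hx].
  by rewrite /code /= !inordK.
rewrite -(num_matchings_iso (f := to_half g) share_edge_sym share_edge_irr
           (@half_edge_sym _) (@half_edge_irr _)); last 2 first.
- by move=> s t sX tX /(congr1 (@code Bd)); rewrite !cE // => /inj e; apply/tcode_inj/e.
- by move=> s t sX tX; rewrite /half_edge !cE // adj // share_edgeE.
congr num_matchings; apply/setP => v; apply/imsetP/idP => [[t tX ->]|vY].
  exact: toY (cE _ tX).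
by have [t tX e] := fromY v vY; exists t => //; apply: code_inj; rewrite cE.
Qed.

Definition left_region (s : seq nat) : {set triangle N M} :=
  [set t in hexagon N M | let: (i, j, b) := tcode t in
     (j < N) || [&& j == N, ~~ b & i \notin s]].

Definition right_region (s : seq nat) : {set triangle N M} :=
  [set t in hexagon N M | let: (i, j, b) := tcode t in
     (N < j) || [&& j == N, b & i \notin s]].

Lemma mem_left s (t : triangle N M) : (t \in left_region s) =
  let: (i, j, b) := tcode t in
  if b then (j < N) && (N <= i + j)
  else [&& 0 < j <= N, N <= i + j & (j < N) || (i \notin s)].
Proof. by rewrite inE mem_hexagon; case: (tcode t) => [[i j] []]; lia. Qed.

Lemma mem_right s (t : triangle N M) : (t \in right_region s) =
  let: (i, j, b) := tcode t in
  if b then [&& N <= j < 2 * N, i + j < 2 * N + M & (N < j) || (i \notin s)]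
  else (N < j) && (i + j < 2 * N + M).
Proof. by rewrite inE mem_hexagon; case: (tcode t) => [[i j] []]; lia. Qed.

Lemma num_matchings_left (s : seq nat) : 0 < N ->
  pm (left_region s) = num_matchings (@half_edge Bd) (half_region M Bd N s).
Proof.
move=> N0.
(* On the left the lower boundary of column [j] is at [a = N - j], from which [x] is measured. A
   triangle pointing right has its vertical side away from the axis, hence [~~ b], and lies in the
   strip after the line [j], hence the level [j + b]. *)
apply: (@num_matchings_to_half (fun '(i, j, b) => (j + b, i + j - N, ~~ b))).
- move=> t; rewrite mem_left; have := ltn_ord t.1.1.
  rewrite -[nat_of_ord t.1.1]/((tcode t).1.1).
  by case: (tcode t) => [[i j] []] /=; lia.
- move=> t t'; rewrite !mem_left.
  case: (tcode t) (tcode t') => [[i j] b] [[i' j'] b'] + + [] /=.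
  by case: b; case: b' => //= h h' e1 e2 _; congr (_, _, _); lia.
- move=> t t'; rewrite !mem_left.
  case: (tcode t) (tcode t') => [[i j] b] [[i' j'] b'] /=.
  by case: b; case: b' => //=; lia.
- move=> t; rewrite mem_left => h v e; rewrite mem_half_region // e; move: h.
  have := ltn_ord t.1.1; rewrite -[nat_of_ord t.1.1]/((tcode t).1.1).
  case: (tcode t) => [[i j] []] /=; first lia.
  have [-> /=|nj] := eqVneq j N; last lia.
  by rewrite addnK; lia.
move=> v; rewrite mem_half_region //.
case: (code v) => [[k x] b] h.
have [t tE] : exists t, tcode t = (x + (N - k) + (~~ b), k - (~~ b), ~~ b).
  by apply: tcodeP; move: h; case: b => /=; lia.
exists t; last first.
  by rewrite tE negbK {t tE}; move: h; case: b => /= ?; congr (_, _, _); lia.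
rewrite mem_left tE {t tE}; move: h; case: b => /=; last lia.
have [->|?] := eqVneq k N; last lia.
by rewrite subnn !addn0; lia.
Qed.

Lemma num_matchings_right (s : seq nat) : 0 < N ->
  pm (right_region s) = num_matchings (@half_edge Bd) (half_region M Bd N s).
Proof.
move=> N0.
(* On the right the lower boundary is [a = 0], so [i] needs no shift, and pointing right now means
   that the vertical side is on the axis side. *)
apply: (@num_matchings_to_half (fun '(i, j, b) => (2 * N - j + ~~ b, i, b))).
- move=> t; rewrite mem_right; have := ltn_ord t.1.1; have := ltn_ord t.1.2.
  rewrite -[nat_of_ord t.1.1]/((tcode t).1.1) -[nat_of_ord t.1.2]/((tcode t).1.2).
  by case: (tcode t) => [[i j] []] /=; lia.
- move=> t t'; rewrite !mem_right.
  have := ltn_ord t.1.2; have := ltn_ord t'.1.2.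
  rewrite -[nat_of_ord t.1.2]/((tcode t).1.2) -[nat_of_ord t'.1.2]/((tcode t').1.2).
  case: (tcode t) (tcode t') => [[i j] b] [[i' j'] b'] + + + + [] /=.
  by case: b; case: b' => //= b1 b2 h h' e1 e2 _; congr (_, _, _); lia.
- move=> t t'; rewrite !mem_right.
  have := ltn_ord t.1.2; have := ltn_ord t'.1.2.
  rewrite -[nat_of_ord t.1.2]/((tcode t).1.2) -[nat_of_ord t'.1.2]/((tcode t').1.2).
  case: (tcode t) (tcode t') => [[i j] b] [[i' j'] b'] /=.
  by case: b; case: b' => //=; lia.
- move=> t; rewrite mem_right => h v e; rewrite mem_half_region // e; move: h.
  have := ltn_ord t.1.2; rewrite -[nat_of_ord t.1.2]/((tcode t).1.2).
  by case: (tcode t) => [[i j] []] /=; lia.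
move=> v; rewrite mem_half_region //.
case: (code v) => [[k x] b] h.
have [t tE] : exists t, tcode t = (x, 2 * N - k + ~~ b, b).
  by apply: tcodeP; move: h; case: b => /=; lia.
exists t; last first.
  by rewrite tE {t tE}; move: h; case: b => /= ?; congr (_, _, _); lia.
by rewrite mem_right tE {t tE}; move: h; case: b => /=; lia.
Qed.

Lemma sorted_enum_ord n (S : {set 'I_n}) : sorted ltn (map val (enum S)).
Proof.
apply: (@subseq_sorted _ _ ltn_trans _ (map val (enum 'I_n))).
  by rewrite map_subseq // enumT filter_subseq.
by rewrite val_enum_ord iota_ltn_sorted.
Qed.

Lemma mem_val_enum n (S : {set 'I_n}) (i : 'I_n) :
  (nat_of_ord i \in map val (enum S)) = (i \in S).
Proof. by rewrite (mem_map val_inj) mem_enum. Qed.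

Lemma num_matchings_half_region (S : {set 'I_(N + M)}) : 0 < N ->
  num_matchings (@half_edge Bd) (half_region M Bd N (map val (enum S))) =
  num_interlacing N (map val (enum S)).
Proof.
move=> N0; rewrite -half_countE // (@half_region_count M Bd) ?sorted_enum_ord //; try lia.
by apply/allP => _ /mapP[x _ ->] /=; have := ltn_ord x; lia.
Qed.

Theorem num_tilings_interlacing (l : 'I_(N + M)) : 0 < N ->
  num_tilings_with_axis_rhombus N M l =
  \sum_(S : {set 'I_(N + M)} | l \in S) num_interlacing N (map val (enum S)) ^ 2.
Proof.
move=> N0.
have jN : N < 2 * N + 1 by lia.
pose t0 (x : 'I_(N + M)) : triangle N M := (x, Ordinal jN, false).
have t0E x : tcode (t0 x) = (nat_of_ord x, N, false) by [].
pose t1 (x : 'I_(N + M)) : triangle N M := (x, Ordinal jN, true).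
have t1E x : tcode (t1 x) = (nat_of_ord x, N, true) by [].
have t0inj : injective t0 by move=> x y [].
have t0P (t : triangle N M) : (tcode t).1.2 = N -> ~~ t.2 -> t = t0 t.1.1.
  by case: t => [[i j] []] //= e _; congr (_, _, _); apply: val_inj.
(* Exchanges the two triangles of each axis rhombus and fixes all others; this is the map [b] of
   [num_matchings_split]. *)
pose flip (t : triangle N M) : triangle N M :=
  (t.1, if nat_of_ord t.1.2 == N then ~~ t.2 else t.2).
have flipE t : tcode (flip t) =
    let: (i, j, b) := tcode t in (i, j, if j == N then ~~ b else b) by [].
have flipinj : injective flip.
  by move=> [[i j] b] [[i' j'] b'] [] -> -> /=; case: ifP => _; case: b; case: b'.
have axisE : axis_rhombus N M l = [set t1 l; t0 l].
  apply/setP => t; rewrite mem_axis_rhombus !inE -!(inj_eq tcode_inj) t0E t1E.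
  by case: (tcode t) => [[i j] []]; rewrite !xpair_eqE; lia.
have edge01 x : share_edge (t1 x) (t0 x).
  by rewrite share_edgeE t0E t1E /= !eqxx.
have hl := ltn_ord l.
transitivity (pm (hexagon N M :\: axis_rhombus N M l)).
  rewrite -card_matchings_block; last 2 first.
  - by rewrite axisE is_edge_set2.
  - apply/subsetP => t; rewrite mem_axis_rhombus mem_hexagon.
    by case: (tcode t) => [[i j] []]; lia.
  by apply: eq_card => T; rewrite !inE.
have -> : hexagon N M :\: axis_rhombus N M l =
    left_region [:: nat_of_ord l] :|: right_region [:: nat_of_ord l].
  apply/setP => t; rewrite in_setD in_setU mem_axis_rhombus mem_hexagon mem_left mem_right.
  by case: (tcode t) => [[i j] []]; rewrite inE; lia.
set A := left_region _; set B := right_region _.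
rewrite (num_matchings_split share_edge_sym share_edge_irr (b := flip)); last 3 first.
- rewrite -setI_eq0; apply/eqP/setP => t; rewrite in_setI in_set0 mem_left mem_right.
  by case: (tcode t) => [[i j] []]; lia.
- move=> u v; rewrite mem_left mem_right share_edgeE => uA vB adj.
  apply: tcode_inj; rewrite flipE; move: uA vB adj.
  case: (tcode u) (tcode v) => [[i j] b] [[i' j'] b'].
  by case: b; case: b' => //= *; have [?|?] := eqVneq j N; congr (_, _, _); lia.
- by move=> u v _ _; apply: flipinj.
have crossE t : (t \in crossing (@share_edge N M) flip A B) =
    ((tcode t).1.2 == N) && ~~ t.2 && (t.1.1 != l).
  have -> : (t.1.1 != l) = ((tcode t).1.1 != l) by [].
  have -> : t.2 = (tcode t).2 by [].
  have := ltn_ord t.1.1; rewrite -[nat_of_ord t.1.1]/((tcode t).1.1).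
  rewrite inE mem_left mem_right share_edgeE flipE.
  case: (tcode t) => [[i j] b] /=; rewrite !inE.
  by have [->|?] := eqVneq j N; case: b; rewrite /= ?eqxx; lia.
(* The rhombus at [l] has already been removed, so the crossing triangles are those of the remaining
   axis rhombi; adding [l] back gives the full set of positions. *)
rewrite (reindex_onto (fun S : {set 'I_(N + M)} => t0 @: (S :\ l))
   (fun R => l |: [set x | t0 x \in R])) /=; last first.
  move=> R /subsetP sR; apply/setP => t; apply/imsetP/idP => [[x]|tR].
    by rewrite !inE => /andP[/negPf ->] /= + ->.
  have := sR t tR; rewrite crossE => /andP[/andP[/eqP tN tb] tl].
  by exists t.1.1; rewrite ?inE ?tl -?t0P // tR orbT.
apply: eq_big => [S|S].
  apply/andP/idP => [[_ /eqP <-]|lS]; first by rewrite !inE eqxx.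
  split; first by apply/subsetP => t /imsetP[x];
    rewrite in_setD1 => /andP[xl _] ->; rewrite crossE /= eqxx.
  apply/eqP/setP => x; rewrite !inE (mem_imset _ _ t0inj) !inE.
  by have [->|] := eqVneq x l.
move=> /andP[_ /eqP eS]; have lS : l \in S by rewrite -eS !inE eqxx.
rewrite -mulnn; congr (_ * _).
  have -> : A :\: t0 @: (S :\ l) = left_region (map val (enum S)).
    apply/setP => t; rewrite in_setD !mem_left.
    have -> : (t \in t0 @: (S :\ l)) = [&& (tcode t).1.2 == N, ~~ (tcode t).2, (tcode t).1.1 != l & (tcode t).1.1 \in map val (enum S)].
      apply/imsetP/and4P => [[x]|[/eqP tN tb tl]].
        by rewrite !inE => /andP[xl xS] ->; rewrite mem_val_enum; split.
      rewrite mem_val_enum => tS; exists t.1.1; last exact: t0P.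
      by rewrite !inE tS andbT.
    have : nat_of_ord l \in map val (enum S) by rewrite mem_val_enum.
    case: (tcode t) => [[i j] []] /= lE; first by rewrite !andbF.
    rewrite inE; have [->|?] := eqVneq i l; first by rewrite lE; lia.
    by lia.
  by rewrite num_matchings_left ?num_matchings_half_region.
have -> : B :\: flip @: (t0 @: (S :\ l)) = right_region (map val (enum S)).
  apply/setP => t; rewrite in_setD !mem_right.
  have -> : (t \in flip @: (t0 @: (S :\ l))) = [&& (tcode t).1.2 == N, (tcode t).2, (tcode t).1.1 != l & (tcode t).1.1 \in map val (enum S)].
    rewrite -imset_comp; apply/imsetP/and4P => [[x]|[/eqP tN tb tl]].
      rewrite !inE => /andP[xl xS] ->; rewrite /= mem_val_enum.
      by rewrite /tcode /= eqxx; split.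
    rewrite mem_val_enum => tS; exists t.1.1; first by rewrite !inE tS andbT.
    apply: tcode_inj; rewrite /= flipE /= eqxx.
    by move: tN tb; rewrite /tcode /=; case: t {tl tS} => [[i j] b] /= -> ->.
  have : nat_of_ord l \in map val (enum S) by rewrite mem_val_enum.
  case: (tcode t) => [[i j] []] /= lE; last by rewrite !andbF.
  rewrite inE; have [->|?] := eqVneq i l; first by rewrite lE; lia.
  by lia.
by rewrite num_matchings_right ?num_matchings_half_region.
Qed.
End Geometry.

End Tilings.

(** * Gelfand-Tsetlin patterns and determinants *)

Lemma sum_bin_range a b j : (a <= b)%N ->
  \sum_(a <= mu < b) 'C(mu, j)%:R = 'C(b, j.+1)%:R - 'C(a, j.+1)%:R :> rat.
Proof.
move=> ab; rewrite -(telescope_sumr (fun i => 'C(i, j.+1)%:R) ab).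
by apply: eq_big_nat => i _; rewrite binS natrD addrAC subrr add0r.
Qed.

Lemma eq_interlacing_sum_size l ls f g :
    (forall c, size c = size ls -> f c = g c) ->
  interlacing_sum l ls f = interlacing_sum l ls g.
Proof.
elim: ls l f g => /= [|l' ls IH] l f g fg; first exact: fg.
by apply: eq_bigr => mu _; apply: IH => c sc; apply: fg; rewrite /= sc.
Qed.

Lemma num_interlacing_size k L : size L != k -> num_interlacing k L = 0%N.
Proof.
elim: k L => [|k IH] [|l ls] //= sL.
rewrite (eq_interlacing_sum_size _ (g := fun=> 0%N)) ?interlacing_sum0 // => c sc.
by apply: IH; rewrite sc.
Qed.

Section Determinant.
Variable n : nat.

Definition rows (s : seq 'rV[rat]_n) : 'M[rat]_n := \matrix_(i < n) nth 0 s i.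

Lemma det_rows_sum (pre post : seq 'rV[rat]_n) (a b : nat) (u : nat -> 'rV[rat]_n) :
  (size pre < n)%N ->
  \det (rows (pre ++ (\sum_(a <= mu < b) u mu) :: post)) =
  \sum_(a <= mu < b) \det (rows (pre ++ u mu :: post)).
Proof.
move=> hn; pose i0 := Ordinal hn.
have rE v j : rows (pre ++ v :: post) i0 j = v 0 j.
  by rewrite mxE nth_cat ltnn subnn.
have cE v w j : cofactor (rows (pre ++ v :: post)) i0 j = cofactor (rows (pre ++ w :: post)) i0 j.
  rewrite /cofactor; congr (_ * \det _); apply/matrixP => i k; rewrite !mxE !nth_cat.
  case: ltnP => // le; have := neq_lift i0 i; rewrite -val_eqE /=.
  by case: (_ - _)%N (subnK le) => [|m] //= <-; rewrite eqxx.
rewrite (expand_det_row _ i0).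
under [RHS]eq_bigr => mu _ do rewrite (expand_det_row _ i0).
rewrite [RHS]exchange_big /=; apply: eq_bigr => j _.
rewrite rE summxE big_distrl /=; apply: eq_bigr => mu _.
by rewrite rE (cE _ (u mu)).
Qed.

(** The range of each [mu] does not depend on the others, so multilinearity moves the sums into the
    determinant one row at a time; [pre] collects the rows already chosen. *)
Lemma interlacing_sum_det (u : nat -> 'rV[rat]_n) l ls f (pre : seq 'rV[rat]_n) :
    (size pre + size ls = n)%N -> path ltn l ls ->
    (forall c, size c = size ls -> sorted ltn c -> all (leq l) c ->
       (f c)%:R = \det (rows (pre ++ map u c))) ->
  (interlacing_sum l ls f)%:R =
  \det (rows (pre ++ pairmap (fun a b => \sum_(a <= mu < b) u mu) l ls)).
Proof.
elim: ls l f pre => [|l' ls IH] l f pre /= hn; first by move=> _ ->.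
move=> /andP[ll' pl] fE; rewrite det_rows_sum; last by lia.
rewrite natr_sum big_nat_cond [RHS]big_nat_cond; apply: eq_bigr => mu /andP[/andP[lmu mul'] _].
rewrite (IH _ _ (rcons pre (u mu))) ?cat_rcons //; first by rewrite size_rcons addSnnS.
move=> c sc srt cl; rewrite fE ?cat_rcons //=; first by rewrite sc.
  by case: c srt cl {sc} => //= z c -> /andP[? _]; rewrite andbT; lia.
by rewrite lmu; apply: sub_all cl => z; lia.
Qed.
End Determinant.

Definition binomial_matrix k (L : seq nat) : 'M[rat]_k :=
  \matrix_(i < k, j < k) 'C(nth 0%N L i, j)%:R.

(** Summing ['C(mu, j)] between consecutive entries of [L] gives differences of ['C(-, j.+1)]. These
    are the rows of the larger matrix [A] after subtraction of consecutive rows, which [S] undoes;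
    the column of [A] at [j = 0] is a unit vector, so expansion along it leaves the smaller
    determinant. *)
Lemma num_interlacing_det k L : size L = k -> sorted ltn L ->
  (num_interlacing k L)%:R = \det (binomial_matrix k L).
Proof.
elim: k L => [|k IH] [|l ls] //= => [_ _|[szl] pl]; first by rewrite det_mx00.
rewrite (@interlacing_sum_det k (fun mu => \row_j 'C(mu, j)%:R) _ _ _ [::]) //; last first.
  move=> c sc srt _; rewrite IH //; last by rewrite sc.
  congr (\det _); apply/matrixP => i j; rewrite !mxE (nth_map 0%N) ?mxE //.
  by rewrite sc szl.
pose S : 'M[rat]_k.+1 := \matrix_(i, j) (j <= i)%N%:R.
pose A : 'M[rat]_k.+1 := \matrix_(i, j)
  (if (i : nat) is 0%N then 'C(l, j)%:R else
   'C(nth 0%N (l :: ls) i, j)%:R - 'C(nth 0%N (l :: ls) i.-1, j)%:R).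
have -> : binomial_matrix k.+1 (l :: ls) = S *m A.
  apply/matrixP => i j; rewrite !mxE.
  pose F (m : nat) : rat := if m is 0%N then 'C(l, j)%:R else
    'C(nth 0%N (l :: ls) m, j)%:R - 'C(nth 0%N (l :: ls) m.-1, j)%:R.
  transitivity (\sum_(0 <= m < i.+1) F m).
    by rewrite big_nat_recl //= telescope_sumr //= addrC subrK.
  rewrite big_mkord (big_ord_widen _ F (ltn_ord i)) big_mkcond /=.
  by apply: eq_bigr => m _; rewrite !mxE ltnS; case: leqP => _; rewrite ?mul1r ?mul0r.
rewrite det_mulmx (_ : \det S = 1) ?mul1r; last first.
  rewrite det_trig; last by apply/is_trig_mxP => i j ij; rewrite mxE leqNgt ij.
  by apply: big1 => i _; rewrite mxE leqnn.
rewrite (expand_det_col A ord0) big_ord_recl big1 ?addr0 => [|i _]; last first.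
  by rewrite !mxE /= !bin0 subrr mul0r.
rewrite !mxE /= bin0 mul1r /cofactor addn0 expr0 mul1r.
congr (\det _); apply/matrixP => i j; rewrite !mxE (nth_pairmap 0%N) ?szl //=.
rewrite summxE; under eq_bigr => mu _ do rewrite mxE.
rewrite sum_bin_range // /bump /= ?add1n //.
have /(sortedP 0%N)/(_ i) : sorted ltn (l :: ls) by [].
by rewrite /= szl ltnS => /(_ (ltn_ord i)) /ltnW.
Qed.

(** * Andreief's identity and sums over sets of positions *)

Section Andreief.
Variables (R : comNzRingType) (N P : nat).

Lemma sum_det_rows (B : 'I_N -> 'I_P -> 'I_N -> R) :
  \sum_(f : {ffun 'I_N -> 'I_P}) \det (\matrix_(i, j) B i (f i) j) =
  \det (\matrix_(i, j) \sum_x B i x j).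
Proof.
rewrite /determinant exchange_big /=; apply: eq_bigr => s _.
rewrite -big_distrr /=; congr (_ * _).
rewrite (eq_bigr (fun i => \sum_x B i x (s i))); last by move=> i _; rewrite mxE.
rewrite bigA_distr_bigA /=; apply: eq_bigr => f _.
by apply: eq_bigr => i _; rewrite mxE.
Qed.

Variables (phi : 'I_N -> 'I_P -> R) (w : 'I_P -> R).

Definition sample_matrix (f : 'I_N -> 'I_P) : 'M[R]_N := \matrix_(i, j) phi j (f i).

(** One determinant is expanded over permutations [s] and its factors are absorbed into the rows of
    the other, whose columns are permuted by [s] too. The sum over [f] then acts on each row
    separately; both signs cancel, so each [s] contributes the same Gram determinant. *)
Lemma andreief :
  \sum_(f : {ffun 'I_N -> 'I_P}) (\prod_i w (f i)) * \det (sample_matrix f) ^+ 2 =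
  N`!%:R * \det (\matrix_(i, j) \sum_x w x * phi i x * phi j x).
Proof.
set G := \matrix_(i, j) _.
transitivity (\sum_(s : 'S_N) \sum_(f : {ffun 'I_N -> 'I_P})
    \det (\matrix_(i, j) (w (f i) * phi (s i) (f i) * phi (s j) (f i)))); last first.
  transitivity (\sum_(s : 'S_N) \det G); last first.
    by rewrite sumr_const card_Sn mulr_natl.
  apply: eq_bigr => s _.
  rewrite (sum_det_rows (fun i x j => w x * phi (s i) x * phi (s j) x)).
  transitivity (\det (row_perm s (col_perm s G))).
    by congr (\det _); apply/matrixP => i j; rewrite !mxE.
  rewrite row_permE col_permE !det_mulmx !det_perm odd_permV.
  by rewrite mulrCA -signr_addb addbb mulr1.
rewrite exchange_big /=; apply: eq_bigr => f _.
rewrite expr2 {1}/determinant big_distrl big_distrr /=; apply: eq_bigr => s _.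
transitivity (\det (diag_mx (\row_i (w (f i) * phi (s i) (f i))) *m
    col_perm s (sample_matrix f))); last first.
  congr (\det _); apply/matrixP => i j; rewrite mul_diag_mx !mxE //.
rewrite det_mulmx det_diag col_permE det_mulmx det_perm odd_permV.
rewrite [X in _ = X * _](_ : _ = (\prod_i w (f i)) * \prod_i sample_matrix f i (s i)).
  by rewrite -[RHS]mulrA; congr (_ * _); rewrite mulrAC [RHS]mulrC; congr (_ * _); exact: mulrC.
by rewrite -big_split; apply: eq_bigr => i _; rewrite !mxE.
Qed.
End Andreief.

(** An [N]-set is the image of [N]! injections, whose determinants differ only in sign; a map that
    is not injective repeats a row. *)
Lemma sum_sets_det (N P : nat) (phi : nat -> nat -> rat) (Q : pred {set 'I_P}) :
  N`!%:R * \sum_(S : {set 'I_P} | (#|S| == N) && Q S)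
     \det (\matrix_(i < N, j < N) phi j (nth 0%N (map val (enum S)) i)) ^+ 2 =
  \sum_(f : {ffun 'I_N -> 'I_P} | Q [set f i | i : 'I_N])
     \det (\matrix_(i < N, j < N) phi j (f i)) ^+ 2.
Proof.
rewrite [RHS](bigID (fun f : {ffun 'I_N -> 'I_P} => injectiveb f)) /=.
rewrite [X in _ = _ + X]big1 ?addr0; last first.
  move=> f /andP[_ /injectivePn[i1 [i2 ni e]]].
  rewrite (determinant_alternate ni) ?expr0n // => j.
  by rewrite !mxE e.
rewrite (partition_big (fun f : {ffun 'I_N -> 'I_P} => [set f i | i : 'I_N])
  (fun S => (#|S| == N) && Q S)) /=; last first.
  by move=> f /andP[-> /injectiveP fi]; rewrite andbT card_imset // card_ord.
rewrite big_distrr /=; apply: eq_bigr => S /andP[/eqP cS QS].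
transitivity (\sum_(f in [set f : {ffun 'I_N -> 'I_P} in ffun_on (mem S) | injectiveb f])
  \det (\matrix_(i < N, j < N) phi j (nth 0%N (map val (enum S)) i)) ^+ 2).
  by rewrite sumr_const card_inj_ffuns_on cS card_ord ffactnn mulr_natl.
apply: eq_big => [f|f].
  rewrite inE; apply/andP/andP => [[/ffun_onP fS fi]|[/andP[Qf fi] /eqP fS]]; last first.
    by split=> //; apply/ffun_onP => i; rewrite -fS imset_f.
  have eS : [set f i | i : 'I_N] = S.
    apply/eqP; rewrite eqEcard card_imset ?card_ord ?cS ?leqnn ?andbT; last exact/injectiveP.
    by apply/subsetP => _ /imsetP[i _ ->]; apply: fS.
  by rewrite eS QS fi.
rewrite inE => /andP[/ffun_onP fS /injectiveP fi].
have sz : size (enum S) = N by rewrite -cardE.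
have gi i : (index (f i) (enum S) < N)%N by rewrite -[X in (_ < X)%N]sz index_mem mem_enum fS.
pose g i := Ordinal (gi i).
have ginj : injective g.
  move=> i j [] e; apply: fi; rewrite -[f i](nth_index (f i) (s := enum S)) ?mem_enum ?fS // e.
  by rewrite nth_index ?mem_enum ?fS.
set M := \matrix_(i, j) _.
have -> : \matrix_(i < N, j < N) phi j (f i) = row_perm (perm ginj) M.
  apply/matrixP => i j; rewrite !mxE permE /=; congr (phi _ _).
  by rewrite (nth_map (f i)) ?index_mem ?mem_enum ?fS // nth_index ?mem_enum ?fS.
by rewrite row_permE det_mulmx det_perm exprMn sqrr_sign mul1r.
Qed.

(** * Discrete Legendre polynomials *)

(** Up to sign, the coefficients of the Legendre polynomial shifted to the interval [0, 1]. *)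
Definition binprod (k i : nat) : rat := 'C(k, i)%:R * 'C(k + i, i)%:R.

Lemma binprod_succr k i :
  binprod k i.+1 * i.+1%:R ^+ 2 = (k%:R - i%:R) * (k + i).+1%:R * binprod k i.
Proof.
rewrite /binprod.
have e1 : 'C(k, i.+1)%:R * i.+1%:R = 'C(k, i)%:R * (k%:R - i%:R) :> rat.
  have [ki|ki] := ltnP k i; first by rewrite !bin_small ?mul0r //; lia.
  by rewrite -natrB // -!natrM mulnC mul_bin_left mulnC.
have e2 : 'C(k + i.+1, i.+1)%:R * i.+1%:R = (k + i).+1%:R * 'C(k + i, i)%:R :> rat.
  by rewrite -!natrM addnS mulnC -mul_bin_diag.
transitivity (('C(k, i.+1)%:R * i.+1%:R) * ('C(k + i.+1, i.+1)%:R * i.+1%:R) : rat); first by ring.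
by rewrite e1 e2; ring.
Qed.

Lemma binprod_succl k i :
  binprod k.+1 i * (k.+1%:R - i%:R) = (k + i).+1%:R * binprod k i.
Proof.
rewrite /binprod; have [ki|ki] := ltnP k i.
  rewrite [in RHS]bin_small // mul0r mulr0.
  have [->|?] := eqVneq i k.+1; first by rewrite subrr mulr0.
  by rewrite bin_small ?mul0r //; lia.
have e1 : 'C(k.+1, i)%:R * (k.+1%:R - i%:R) = k.+1%:R * 'C(k, i)%:R :> rat.
  rewrite -natrB ?leqW // -!natrM; congr (_%:R).
  by rewrite mulnC -mul_bin_down.
have e2 : 'C(k.+1 + i, i)%:R * k.+1%:R = (k + i).+1%:R * 'C(k + i, i)%:R :> rat.
  rewrite -!natrM; congr (_%:R); rewrite mulnC addSn.
  by have := mul_bin_down (k + i).+1 i; rewrite /= -addSn addnK addSn => <-.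
have k0 : k.+1%:R != 0 :> rat by rewrite pnatr_eq0.
apply: (mulIf k0).
transitivity (('C(k.+1, i)%:R * (k.+1%:R - i%:R)) * ('C(k.+1 + i, i)%:R * k.+1%:R) : rat).
  by ring.
by rewrite e1 e2; ring.
Qed.

(** The last relation keeps the factor [k%:R] on both sides, since [k.-1] is not k - 1 at
    [k = 0]. *)
Lemma binprod_rel k i : (i <= k)%N ->
  [/\ binprod k.+1 i.+1 * i.+1%:R ^+ 2 = (k%:R + i%:R + 2) * (k%:R + i%:R + 1) * binprod k i,
      binprod k i.+1 * i.+1%:R ^+ 2 = (k%:R - i%:R) * (k%:R + i%:R + 1) * binprod k i &
      k%:R * (binprod k.-1 i.+1 * i.+1%:R ^+ 2) =
        k%:R * ((k%:R - i%:R - 1) * (k%:R - i%:R) * binprod k i)].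
Proof.
move=> ik; have hi : i.+1%:R = i%:R + 1 :> rat by rewrite -natr1.
have hki : (k + i).+1%:R = k%:R + i%:R + 1 :> rat by rewrite -natr1 natrD.
split.
- have hk : k.+1%:R = k%:R + 1 :> rat by rewrite -natr1.
  have hki2 : (k.+1 + i).+1%:R = k%:R + i%:R + 2 :> rat by rewrite -natr1 addSn hki; ring.
  rewrite binprod_succr hki2 hk.
  have := binprod_succl k i; rewrite hki hk => E.
  transitivity ((k%:R + i%:R + 2) * (binprod k.+1 i * (k%:R + 1 - i%:R))); first by ring.
  by rewrite E; ring.
- by rewrite binprod_succr hki.
case: k ik hki => [|k] ik hki; first by rewrite !mul0r.
congr (_ * _); rewrite /= binprod_succr.
have := binprod_succl k i; rewrite -natr1 -[(k + i).+1%:R]natr1 natrD => E.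
transitivity ((k%:R - i%:R) * ((k%:R + i%:R + 1) * binprod k i)); first by ring.
by rewrite -E; ring.
Qed.

Section Legendre.
Variable P : nat.

(* [leg k] is the discrete Legendre (Gram) polynomial of degree [k] on
   [{0, ..., P - 1}], with value 1 at 0. *)
Definition leg_coef (k i : nat) : rat := (-1) ^+ i * binprod k i / 'C(P.-1, i)%:R.

Definition leg (k x : nat) : rat := \sum_(0 <= i < k.+1) leg_coef k i * 'C(x, i)%:R.

Lemma leg_coef_small k i : (k < i)%N -> leg_coef k i = 0.
Proof. by move=> ki; rewrite /leg_coef /binprod bin_small // !(mul0r, mulr0). Qed.

Lemma leg_widen k b x : (k < b)%N -> leg k x = \sum_(0 <= i < b) leg_coef k i * 'C(x, i)%:R.
Proof.
move=> kb; rewrite [RHS](big_cat_nat (n := k.+1)) //= -[LHS]addr0; congr (_ + _).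
rewrite big_nat_cond big1 // => i /andP[/andP[ki _] _].
by rewrite leg_coef_small ?mul0r.
Qed.

Lemma leg0 x : leg 0 x = 1.
Proof. by rewrite /leg big_nat1 /leg_coef /binprod !bin0 expr0 !mulr1n !mul1r ?invr1. Qed.

Lemma leg_coef_rec k i : (i <= k)%N -> (i.+1 < P)%N ->
  k.+1%:R * (P%:R - 1 - k%:R) * leg_coef k.+1 i.+1 =
  (2 * k%:R + 1) * (P%:R - 1 - 2 * i.+1%:R) * leg_coef k i.+1
  - 2 * (2 * k%:R + 1) * i.+1%:R * leg_coef k i
  - k%:R * (P%:R + k%:R) * leg_coef k.-1 i.+1.
Proof.
move=> ik iP; have [E1 E2 E3] := binprod_rel ik.
have i0 : i.+1%:R != 0 :> rat by rewrite pnatr_eq0.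
have c0 : 'C(P.-1, i.+1)%:R != 0 :> rat by rewrite pnatr_eq0 -lt0n bin_gt0; lia.
have c1 : 'C(P.-1, i)%:R != 0 :> rat by rewrite pnatr_eq0 -lt0n bin_gt0; lia.
have ec : 'C(P.-1, i)%:R = 'C(P.-1, i.+1)%:R * i.+1%:R / (P%:R - 1 - i%:R) :> rat.
  have d0 : P%:R - 1 - i%:R != 0 :> rat.
    by have -> : P%:R - 1 - i%:R = (P - 1 - i)%:R :> rat; [rewrite !natrB //; lia|rewrite pnatr_eq0; lia].
  apply: (mulIf d0); rewrite divfK // -natrM mulnC mul_bin_left.
  by rewrite natrM mulrC (_ : P.-1 - i = P - 1 - i)%N ?natrB //; lia.
have d0 : P%:R - 1 - i%:R != 0 :> rat.
  by have -> : P%:R - 1 - i%:R = (P - 1 - i)%:R :> rat; [rewrite !natrB //; lia|rewrite pnatr_eq0; lia].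
rewrite /leg_coef ec exprS.
have {}E1 : binprod k.+1 i.+1 = (k%:R + i%:R + 2) * (k%:R + i%:R + 1) * binprod k i / i.+1%:R ^+ 2.
  by rewrite -E1 mulfK // expf_neq0.
have {}E2 : binprod k i.+1 = (k%:R - i%:R) * (k%:R + i%:R + 1) * binprod k i / i.+1%:R ^+ 2.
  by rewrite -E2 mulfK // expf_neq0.
have {}E3 : k%:R * binprod k.-1 i.+1 = k%:R * ((k%:R - i%:R - 1) * (k%:R - i%:R) * binprod k i) / i.+1%:R ^+ 2.
  by rewrite -E3 mulrA mulfK // expf_neq0.
transitivity ((2 * k%:R + 1) * (P%:R - 1 - 2 * i.+1%:R) * (-1 * (-1) ^+ i * binprod k i.+1 / 'C(P.-1, i.+1)%:R) -
   2 * (2 * k%:R + 1) * i.+1%:R * ((-1) ^+ i * binprod k i / ('C(P.-1, i.+1)%:R * i.+1%:R / (P%:R - 1 - i%:R))) -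
   (P%:R + k%:R) * (-1 * (-1) ^+ i * (k%:R * binprod k.-1 i.+1) / 'C(P.-1, i.+1)%:R)); last by ring.
rewrite E1 E2 E3.
move: c0 i0 d0; rewrite -!natr1; set s := (-1) ^+ i; set c := 'C(_, _)%:R; set b := binprod k i.
move: s c b (k%:R : rat) (i%:R : rat) (P%:R : rat) => s c b k' i' P' c0 i0 d0.
by field; rewrite c0 i0 d0.
Qed.

Lemma leg_coef0 k : leg_coef k 0 = 1.
Proof. by rewrite /leg_coef /binprod !bin0 expr0 !mulr1n !mul1r ?invr1. Qed.

Lemma leg_recl k b x : (k < b.+1)%N ->
  leg k x = 1 + \sum_(0 <= i < b) leg_coef k i.+1 * 'C(x, i.+1)%:R.
Proof. by move=> kb; rewrite (leg_widen _ kb) big_nat_recl // leg_coef0 bin0 mul1r. Qed.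

Lemma leg_mulX k x : x%:R * leg k x =
  \sum_(0 <= i < k.+1) i.+1%:R * (leg_coef k i.+1 + leg_coef k i) * 'C(x, i.+1)%:R.
Proof.
have xC i : x%:R * 'C(x, i)%:R = i%:R * 'C(x, i)%:R + i.+1%:R * 'C(x, i.+1)%:R :> rat.
  rewrite -!natrM -natrD; congr (_%:R); rewrite mul_bin_left -mulnDl.
  by have [ix|xi] := leqP i x; [rewrite subnKC | rewrite bin_small // !muln0].
transitivity (\sum_(0 <= i < k.+1) leg_coef k i * (i%:R * 'C(x, i)%:R) +
   \sum_(0 <= i < k.+1) leg_coef k i * (i.+1%:R * 'C(x, i.+1)%:R)).
  rewrite -big_split /= /leg big_distrr /=; apply: eq_bigr => i _.
  by rewrite mulrCA xC mulrDr.
transitivity (\sum_(0 <= i < k.+1) leg_coef k i.+1 * (i.+1%:R * 'C(x, i.+1)%:R) +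
   \sum_(0 <= i < k.+1) leg_coef k i * (i.+1%:R * 'C(x, i.+1)%:R)).
  congr (_ + _); rewrite big_nat_recl // mul0r mulr0 add0r.
  by rewrite [RHS]big_nat_recr //= [in X in _ = _ + X]leg_coef_small // mul0r addr0.
by rewrite -big_split /=; apply: eq_bigr => i _; ring.
Qed.

Lemma leg_rec k x : (k < P)%N -> (x < P)%N ->
  k.+1%:R * (P%:R - 1 - k%:R) * leg k.+1 x =
  (2 * k%:R + 1) * (P%:R - 1 - 2 * x%:R) * leg k x - k%:R * (P%:R + k%:R) * leg k.-1 x.
Proof.
move=> kP xP.
have -> : (2 * k%:R + 1) * (P%:R - 1 - 2 * x%:R) * leg k x =
  (2 * k%:R + 1) * (P%:R - 1) * leg k x - 2 * (2 * k%:R + 1) * (x%:R * leg k x) by ring.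
rewrite leg_mulX !(@leg_recl _ k.+1) //; try lia.
set S1 := \sum_(0 <= i < _) _; set S2 := \sum_(0 <= i < _) _.
set S3 := \sum_(0 <= i < _) _; set S4 := \sum_(0 <= i < _) _.
have E : k.+1%:R * (P%:R - 1 - k%:R) * S1 = (2 * k%:R + 1) * (P%:R - 1) * S2
   - 2 * (2 * k%:R + 1) * S3 - k%:R * (P%:R + k%:R) * S4.
  rewrite /S1 /S2 /S3 /S4 !big_distrr /= -!sumrB; apply: eq_big_nat => i /andP[_ ik].
  (* Beyond this bound the coefficients involve a division by ['C(P.-1, i.+1) = 0], but
     ['C(x, i.+1)] vanishes there because [x < P]. *)
  have [iP|Pi] := ltnP i.+1 P; last by rewrite bin_small ?mulr0 ?subr0 //; lia.
  transitivity (k.+1%:R * (P%:R - 1 - k%:R) * leg_coef k.+1 i.+1 * 'C(x, i.+1)%:R); first by ring.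
  by rewrite leg_coef_rec //; ring.
by rewrite mulrDr E -natr1; ring.
Qed.

(** The closed form of all partial sums makes the induction possible; the full sum [I = k.+1] is
    zero because [binprod k k.+1] is. *)
Lemma sum_binprod_alt k I : (0 < k)%N ->
  k%:R * (k%:R + 1) * \sum_(0 <= i < I) (-1) ^+ i * binprod k i / i.+1%:R =
  - (-1) ^+ I * I%:R * binprod k I.
Proof.
move=> k0; elim: I => [|I IH]; first by rewrite big_nil !mulr0 mul0r.
rewrite big_nat_recr //= mulrDr IH.
have i0 : I.+1%:R != 0 :> rat by rewrite pnatr_eq0.
have /(canRL (mulfK _)) E := binprod_succr k I.
rewrite {}E ?expf_neq0 // exprS.
rewrite -[(k + I).+1%:R]natr1 natrD; move: i0; rewrite -natr1.
set s := (-1) ^+ I; set b := binprod k I; move: s b (k%:R : rat) (I%:R : rat) => s b k' i' i0.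
by field; rewrite i0.
Qed.

Lemma sum_leg k : (0 < k < P)%N -> \sum_(0 <= x < P) leg k x = 0.
Proof.
move=> /andP[k0 kP]; rewrite /leg exchange_big /=.
transitivity (P%:R * \sum_(0 <= i < k.+1) (-1) ^+ i * binprod k i / i.+1%:R : rat).
  rewrite big_distrr /=; apply: eq_big_nat => i /andP[_ ik].
  rewrite -big_distrr /= sum_bin_range // bin0n subr0 /leg_coef.
  have c0 : 'C(P.-1, i)%:R != 0 :> rat by rewrite pnatr_eq0 -lt0n bin_gt0; lia.
  have i0 : i.+1%:R != 0 :> rat by rewrite pnatr_eq0.
  have /(canRL (mulfK i0)) -> : 'C(P, i.+1)%:R * i.+1%:R = P%:R * 'C(P.-1, i)%:R :> rat.
    by rewrite -!natrM mulnC -mul_bin_diag.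
  move: c0 i0; set c := 'C(_, _)%:R; set j := i.+1%:R; set s := (-1) ^+ i; set b := binprod k i.
  by move: c j s b (P%:R : rat) => c j s b p c0 i0; field; rewrite c0 i0.
have /mulfI : k%:R * (k%:R + 1) != 0 :> rat.
  by rewrite mulf_neq0 // ?natr1 pnatr_eq0 //; lia.
have := sum_binprod_alt k.+1 k0; rewrite /binprod [in 'C(k, k.+1)]bin_small // mul0r !mulr0 => E.
move=> inj; suff -> : \sum_(0 <= i < k.+1) (-1) ^+ i * binprod k i / i.+1%:R = 0 by rewrite mulr0.
by apply: inj; rewrite E mulr0.
Qed.

Definition leg_dot (j k : nat) : rat := \sum_(0 <= x < P) leg j x * leg k x.

Lemma leg_dotC j k : leg_dot j k = leg_dot k j.
Proof. by apply: eq_bigr => x _; rewrite mulrC. Qed.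

(** The matrix of multiplication by P - 1 - 2x. Being symmetric, it lets the three-term recurrence
    be applied to either factor. *)
Definition leg_mom (j k : nat) : rat :=
  \sum_(0 <= x < P) (P%:R - 1 - 2 * x%:R) * leg j x * leg k x.

Lemma leg_momC j k : leg_mom j k = leg_mom k j.
Proof. by apply: eq_bigr => x _; rewrite mulrAC. Qed.

Lemma leg_dot_rec j k : (j < P)%N ->
  j.+1%:R * (P%:R - 1 - j%:R) * leg_dot j.+1 k =
  (2 * j%:R + 1) * leg_mom j k - j%:R * (P%:R + j%:R) * leg_dot j.-1 k.
Proof.
move=> jP; rewrite /leg_dot /leg_mom !big_distrr /= -sumrB.
apply: eq_big_nat => x /andP[_ xP].
transitivity (j.+1%:R * (P%:R - 1 - j%:R) * leg j.+1 x * leg k x); first by ring.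
by rewrite leg_rec //; ring.
Qed.

(** The recurrence in the smaller index reduces the claim to [leg_mom j k = 0], and the recurrence
    in the larger index expresses this moment by products of [leg j] with degrees k - 1 and k + 1,
    which vanish by induction. *)
Lemma leg_orthogonal j k : (j < k < P)%N -> leg_dot j k = 0.
Proof.
elim/ltn_ind: j k => -[|j] IH k /andP[jk kP].
  rewrite /leg_dot; under eq_bigr => x _ do rewrite leg0 mul1r.
  by rewrite sum_leg // jk.
have c0 : j.+1%:R * (P%:R - 1 - j%:R) != 0 :> rat.
  rewrite mulf_neq0 ?pnatr_eq0 //.
  have -> : P%:R - 1 - j%:R = (P - 1 - j)%:R :> rat by rewrite !natrB //; lia.
  by rewrite pnatr_eq0; lia.
apply: (mulfI c0); rewrite mulr0 leg_dot_rec; last lia.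
have -> : j%:R * (P%:R + j%:R) * leg_dot j.-1 k = 0.
  by case: j {c0} IH jk => [|j] IH jk; rewrite ?mul0r // IH ?mulr0 //=; lia.
have c1 : 2 * k%:R + 1 != 0 :> rat by rewrite -natrM natr1 pnatr_eq0.
suff -> : leg_mom j k = 0 by rewrite mulr0 subr0.
apply: (mulfI c1); rewrite mulr0 leg_momC.
have := leg_dot_rec j kP.
have -> : leg_dot k.-1 j = 0 by rewrite leg_dotC IH //; lia.
have -> : k.+1%:R * (P%:R - 1 - k%:R) * leg_dot k.+1 j = 0.
  have [kP1|] := ltnP k.+1 P; first by rewrite leg_dotC IH ?mulr0 //; lia.
  move=> Pk; have -> : P = k.+1 by lia.
  by rewrite -natr1 addrK subrr mulr0 mul0r.
by rewrite mulr0 subr0 => <-.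
Qed.

(** Both norms come from the single moment [leg_mom j j.+1], evaluated by the recurrence in each of
    its two indices. *)
Lemma leg_norm_rec j : (j.+1 < P)%N ->
  (P%:R - 1 - j%:R) * (2 * j%:R + 3) * leg_dot j.+1 j.+1 =
  (2 * j%:R + 1) * (P%:R + j%:R + 1) * leg_dot j j.
Proof.
move=> jP.
have j0 : j.+1%:R != 0 :> rat by rewrite pnatr_eq0.
have E1 := leg_dot_rec j.+1 (ltnW jP).
have := leg_dot_rec j jP; rewrite -[j.+1.-1]/j.
have -> : j.+2%:R * (P%:R - 1 - j.+1%:R) * leg_dot j.+2 j = 0.
  have [?|?] := ltnP j.+2 P; first by rewrite leg_dotC leg_orthogonal ?mulr0 //; lia.
  have -> : P = j.+2 by lia.
  by rewrite -[j.+2%:R]natr1 addrK subrr mulr0 mul0r.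
move: E1; have -> : j%:R * (P%:R + j%:R) * leg_dot j.-1 j.+1 = 0.
  case: j jP {j0} => [|j] jP; rewrite ?mul0r // leg_orthogonal ?mulr0 //=; lia.
rewrite subr0 (leg_momC j.+1) => E1 E2.
apply: (mulfI j0).
transitivity ((2 * j%:R + 3) * (j.+1%:R * (P%:R - 1 - j%:R) * leg_dot j.+1 j.+1)); first by ring.
rewrite E1.
have E3 : (2 * j.+1%:R + 1) * leg_mom j j.+1 = j.+1%:R * (P%:R + j.+1%:R) * leg_dot j j.
  by apply/eqP; rewrite -subr_eq0 -E2.
transitivity ((2 * j%:R + 1) * ((2 * j.+1%:R + 1) * leg_mom j j.+1)); first by rewrite -natr1; ring.
by rewrite E3 -natr1; ring.
Qed.

Lemma leg_dot00 : leg_dot 0 0 = P%:R.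
Proof.
rewrite /leg_dot; under eq_bigr => x _ do rewrite leg0 mul1r.
by rewrite big_const_nat subn0 iter_addr_0.
Qed.

Lemma leg_norm_neq0 j : (j < P)%N -> leg_dot j j != 0.
Proof.
elim: j => [|j IH] jP; first by rewrite leg_dot00 pnatr_eq0; lia.
have := leg_norm_rec jP; apply: contra_eqN => /eqP ->; rewrite mulr0 eq_sym.
rewrite !mulf_neq0 ?IH //; first by rewrite -natrM natr1 pnatr_eq0.
  by rewrite -natrD natr1 pnatr_eq0.
lia.
Qed.
End Legendre.

(** The bordered matrix [M] is made block triangular in two ways: row operations leave the left-hand
    side, column operations the right-hand side. *)
Lemma det_diag_sub_rank1 (F : fieldType) n (d v : 'rV[F]_n) :
  (forall i, d 0 i != 0) ->
  \det (diag_mx d - v^T *m v) = (\prod_i d 0 i) * (1 - \sum_i v 0 i ^+ 2 / d 0 i).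
Proof.
move=> d0; pose M := block_mx (1%:M : 'M_1) v v^T (diag_mx d).
have E1 : \det M = \det (diag_mx d - v^T *m v).
  have := det_mulmx (block_mx (1%:M : 'M_1) 0 (- v^T) (1%:M : 'M_n)) M.
  rewrite det_lblock !det1 !mul1r => <-.
  rewrite mulmx_block !mul1mx !mul0mx !addr0 mulmx1 addNr mulNmx det_ublock det1 mul1r.
  by rewrite addrC.
pose e := \row_i (d 0 i)^-1.
have dE : diag_mx d *m diag_mx e = 1%:M.
  by rewrite mulmx_diag; apply/matrixP => i j; rewrite !mxE divff ?mulr1n.
have E2 : \det M = (1 - \sum_i v 0 i ^+ 2 / d 0 i) * \prod_i d 0 i.
  have := det_mulmx M (block_mx (1%:M : 'M_1) 0 (- (diag_mx e *m v^T)) (1%:M : 'M_n)).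
  rewrite det_lblock !det1 !mulr1 => <-.
  rewrite mulmx_block !mulmx1 !mulmx0 !add0r !mulmxN (mulmxA (diag_mx d)) dE mul1mx subrr.
  rewrite det_ublock det_diag det_mx11; congr (_ * _).
  rewrite !mxE eqxx; congr (1 - _); apply: eq_bigr => i _.
  by rewrite mul_diag_mx !mxE expr2 mulrCA mulrC.
by rewrite -E1 E2 mulrC.
Qed.

(** * The Christoffel-Darboux kernel *)

Section Kernel.
Variables (N P : nat).
Hypothesis leNP : (N <= P)%N.

Lemma leg_coef_diag_neq0 j : (j < P)%N -> leg_coef P j j != 0.
Proof.
move=> jP; rewrite /leg_coef /binprod binn mul1r !mulf_neq0 ?signr_eq0 ?invr_eq0 //.
  by rewrite pnatr_eq0 -lt0n bin_gt0 leq_addl.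
by rewrite pnatr_eq0 -lt0n bin_gt0; lia.
Qed.

Lemma det_leg_matrix (f : nat -> nat) :
  \det (\matrix_(i < N, j < N) leg P j (f i)) =
  \det (\matrix_(i < N, j < N) 'C(f i, j)%:R) * \prod_(j < N) leg_coef P j j.
Proof.
pose A : 'M[rat]_N := \matrix_(i, j) leg_coef P i j.
have -> : \matrix_(i < N, j < N) leg P j (f i) = \matrix_(i < N, j < N) 'C(f i, j)%:R *m A^T.
  apply/matrixP => i j; rewrite !mxE (leg_widen _ _ (ltn_ord j)) big_mkord.
  by apply: eq_bigr => k _; rewrite !mxE mulrC.
rewrite det_mulmx det_tr; congr (_ * _); rewrite det_trig.
  by apply: eq_bigr => i _; rewrite mxE.
by apply/is_trig_mxP => i j ij; rewrite mxE leg_coef_small.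
Qed.

Lemma leg_gram (i j : 'I_N) :
  \sum_(x < P) leg P i x * leg P j x = (leg_dot P i i) *+ (i == j).
Proof.
rewrite -(big_mkord xpredT (fun x => leg P i x * leg P j x)) -/(leg_dot P i j).
have [-> //|] := eqVneq i j; rewrite -val_eqE /= neq_ltn mulr0n => /orP[] ij.
  by rewrite leg_orthogonal //; have := ltn_ord j; lia.
by rewrite leg_dotC leg_orthogonal //; have := ltn_ord i; lia.
Qed.

(** [andreief] is applied with weight 1 and with the weight that vanishes at [l]. The second Gram
    matrix is the first, which is diagonal, minus a matrix of rank one, and the difference of the
    two sums keeps exactly the maps that hit [l]. *)
Lemma sum_det_leg_hit (l : 'I_P) :
  \sum_(f : {ffun 'I_N -> 'I_P} | l \in [set f i | i : 'I_N])
    \det (\matrix_(i < N, j < N) leg P j (f i)) ^+ 2 =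
  N`!%:R * ((\prod_(k < N) leg_dot P k k) * \sum_(k < N) leg P k l ^+ 2 / leg_dot P k k).
Proof.
pose phi (j : 'I_N) (x : 'I_P) := leg P j x.
pose d : 'rV[rat]_N := \row_k leg_dot P k k.
pose v : 'rV[rat]_N := \row_k leg P k l.
have d0 i : d 0 i != 0 by rewrite mxE leg_norm_neq0 // (leq_trans (ltn_ord i)).
have dE : \prod_(k < N) leg_dot P k k = \prod_k d 0 k by apply: eq_bigr => k _; rewrite mxE.
have := andreief phi (fun x => (x != l)%:R).
have := andreief phi (fun=> 1).
have -> : \matrix_(i, j) \sum_x 1 * phi i x * phi j x = diag_mx d.
  apply/matrixP => i j; rewrite !mxE -leg_gram; apply: eq_bigr => x _.
  by rewrite mul1r.
have -> : \matrix_(i, j) \sum_x (x != l)%:R * phi i x * phi j x = diag_mx d - v^T *m v.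
  apply/matrixP => i j; rewrite !mxE big_ord1 !mxE -leg_gram.
  rewrite (bigD1 l) //= eqxx !mul0r add0r [in RHS](bigD1 l) //= addrAC subrr add0r.
  by apply: eq_bigr => x ->; rewrite mul1r.
rewrite det_diag det_diag_sub_rank1 // => E1 E2.
transitivity (N`!%:R * (\prod_i d 0 i) -
   N`!%:R * ((\prod_i d 0 i) * (1 - \sum_i v 0 i ^+ 2 / d 0 i))); last first.
  rewrite dE [X in _ = _ * (_ * X)](_ : _ = \sum_k v 0 k ^+ 2 / d 0 k); first by ring.
  by apply: eq_bigr => k _; rewrite !mxE.
rewrite -E1 -E2 -sumrB [RHS](bigID (fun f : {ffun 'I_N -> 'I_P} => l \in [set f i | i : 'I_N])) /=.
rewrite [X in _ = _ + X]big1 ?addr0 => [|f /negP lf]; last first.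
  apply/eqP; rewrite subr_eq0; apply/eqP; congr (_ * _).
  rewrite !big1 // => i _; case: eqP => // e; case: lf; apply/imsetP; by exists i.
apply: eq_bigr => f /imsetP[i _ e].
rewrite big1 // mul1r [X in _ - X](_ : _ = 0) ?subr0 //.
by rewrite (bigD1 i) //= -e eqxx !mul0r.
Qed.

(** The squared leading coefficients undo the change of basis, so the first product is the Gram
    determinant of the binomials ['C(x, j)], that is, the sum without the condition on [l]. *)
Lemma sum_interlacing_kernel (l : 'I_P) :
  (\sum_(S : {set 'I_P} | l \in S) num_interlacing N (map val (enum S)) ^ 2)%:R =
  (\prod_(k < N) (leg_dot P k k / leg_coef P k k ^+ 2)) *
    \sum_(k < N) leg P k l ^+ 2 / leg_dot P k k :> rat.
Proof.
have N0 : N`!%:R != 0 :> rat by rewrite pnatr_eq0 -lt0n fact_gt0.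
pose c := \prod_(k < N) leg_coef P k k.
have c0 : c != 0.
  by apply/prodf_neq0 => k _; rewrite leg_coef_diag_neq0 // (leq_trans (ltn_ord k)).
have -> : \prod_(k < N) (leg_dot P k k / leg_coef P k k ^+ 2) =
    (\prod_(k < N) leg_dot P k k) / c ^+ 2.
  by rewrite big_split /= prodfV prodrXl.
apply: (mulfI N0); apply: (mulIf (expf_neq0 2 c0)).
transitivity (N`!%:R * ((\prod_(k < N) leg_dot P k k) *
   \sum_(k < N) leg P k l ^+ 2 / leg_dot P k k)); last by field.
rewrite -sum_det_leg_hit.
rewrite -(@sum_sets_det N P (fun j x => leg P j x) (fun S => l \in S)).
rewrite -mulrA; congr (_ * _); rewrite natr_sum (bigID (fun S : {set 'I_P} => #|S| == N)) /=.
rewrite [X in _ + X]big1 ?addr0; last first.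
  by move=> S /andP[_ nS]; rewrite num_interlacing_size // size_map -cardE.
rewrite big_distrl /=; apply: eq_big => [S|S /andP[_ /eqP cS]]; first by rewrite andbC.
rewrite natrX num_interlacing_det ?sorted_enum_ord ?size_map -?cardE //.
by rewrite (det_leg_matrix (nth 0%N (map val (enum S)))) exprMn.
Qed.
End Kernel.

Lemma num_tilings_kernel (N M : nat) (l : 'I_(N + M)) : (0 < N)%N ->
  (num_tilings_with_axis_rhombus N M l)%:R =
  (\prod_(k < N) (leg_dot (N + M) k k / leg_coef (N + M) k k ^+ 2)) *
    \sum_(k < N) leg (N + M) k l ^+ 2 / leg_dot (N + M) k k :> rat.
Proof.
by move=> N0; rewrite num_tilings_interlacing // sum_interlacing_kernel // leq_addr.
Qed.

(** * The kernel at the center *)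

Definition cbin (m : nat) : rat := 'C(2 * m, m)%:R.

Lemma cbin0 : cbin 0 = 1.
Proof. by []. Qed.

Lemma cbin_neq0 m : cbin m != 0.
Proof. by rewrite pnatr_eq0 -lt0n bin_gt0; lia. Qed.

Lemma cbinS m : cbin m.+1 * (m%:R + 1) = 2 * (2 * m%:R + 1) * cbin m.
Proof.
have m0 : m.+1%:R != 0 :> rat by rewrite pnatr_eq0.
have m1 : m.+1%:R = m%:R + 1 :> rat by rewrite -natr1.
have e : (2 * m).+1%:R = 2 * m%:R + 1 :> rat by rewrite -natr1 natrM.
have E : cbin m.+1 * m.+1%:R ^+ 2 = (2 * m).+2%:R * (2 * m).+1%:R * cbin m.
  rewrite /cbin -!natrX -!natrM; congr (_%:R).
  have h1 := mul_bin_diag (2 * m).+2 m; have h2 := mul_bin_down (2 * m).+1 m.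
  have e1 : (2 * m.+1 = (2 * m).+2)%N by lia.
  have e2 : ((2 * m).+1 - m = m.+1)%N by lia.
  rewrite e1; rewrite /= e2 in h1 h2; nia.
have e2 : (2 * m).+2%:R = 2 * m%:R + 2 :> rat by rewrite -natr1 e; ring.
apply: (mulIf m0); transitivity (cbin m.+1 * m.+1%:R ^+ 2); first by rewrite m1; ring.
by rewrite E e e2 m1; ring.
Qed.

Lemma cbin_pred m : (0 < m)%N -> cbin m = 2 * 'C(2 * m - 1, m)%:R.
Proof.
case: m => // m _; rewrite /cbin -natrM; congr (_%:R).
have -> : (2 * m.+1 = (2 * m).+2)%N by lia.
rewrite binS subn1 /=.
have -> : 'C((2 * m).+1, m) = 'C((2 * m).+1, m.+1).
  by rewrite -bin_sub; [congr 'C(_, _); lia | lia].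
lia.
Qed.

(** * Sums of products of central binomial coefficients *)

Section Sums.
Variable s : nat.
Hypothesis s0 : (0 < s)%N.
Let S : rat := s%:R.

Definition cprod (n j : nat) : rat := cbin (n + j) * cbin (n - j).

Definition xsum (n : nat) : rat :=
  - (n%:R * cbin n ^+ 2 / S ^+ 2) +
  \sum_(1 <= j < n.+1) 2 * j%:R * cprod n j / (S ^+ 2 - j%:R ^+ 2).

(* [cprod n j / cbin n ^+ 2] is the hypergeometric factor of the summand of index
   [h = j - 1] in the theorem, and [qcoef n * xsum n] is its right-hand side
   without the triple product, for [s = n + m]. *)
Lemma cprod_telescope n j : (j <= n)%N ->
  4 * j%:R * cprod n j / ((n%:R + 1) ^+ 2 - j%:R ^+ 2) =
  cbin (n + j.+1) * cbin (n.+1 - j.+1) - cbin (n + j) * cbin (n.+1 - j).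
Proof.
move=> jn; rewrite /cprod subSS addnS subSn //.
have /(canRL (mulfK _)) E1 := cbinS (n + j).
have /(canRL (mulfK _)) E2 := cbinS (n - j).
have nj : j%:R <= n%:R :> rat by rewrite ler_nat.
have j0 : 0 <= j%:R :> rat by exact: ler0n.
have a1 : n%:R + j%:R + 1 != 0 :> rat by rewrite gt_eqF //; lra.
have a2 : n%:R - j%:R + 1 != 0 :> rat by rewrite gt_eqF //; lra.
rewrite natrD in E1; rewrite natrB // in E2.
rewrite E1 // E2 //.
have a3 : (n%:R + 1) ^+ 2 - j%:R ^+ 2 != 0 :> rat.
  have -> : (n%:R + 1) ^+ 2 - j%:R ^+ 2 = (n%:R + j%:R + 1) * (n%:R - j%:R + 1) :> rat by ring.
  by rewrite mulf_neq0.
move: a1 a2 a3; set c := cbin (n + j); set d := cbin (n - j).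
move: c d (n%:R : rat) (j%:R : rat) => c d x y a1 a2 a3.
by field; rewrite a1 a2 a3.
Qed.

Lemma cprod_succ n j : (j <= n)%N ->
  cprod n.+1 j = 4 * (2 * n%:R + 1 + 2 * j%:R) * (2 * n%:R + 1 - 2 * j%:R) * cprod n j
                 / ((n%:R + 1) ^+ 2 - j%:R ^+ 2).
Proof.
move=> jn; rewrite /cprod addSn subSn //.
have /(canRL (mulfK _)) E1 := cbinS (n + j).
have /(canRL (mulfK _)) E2 := cbinS (n - j).
have nj : j%:R <= n%:R :> rat by rewrite ler_nat.
have j0 : 0 <= j%:R :> rat by exact: ler0n.
have a1 : n%:R + j%:R + 1 != 0 :> rat by rewrite gt_eqF //; lra.
have a2 : n%:R - j%:R + 1 != 0 :> rat by rewrite gt_eqF //; lra.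
rewrite natrD in E1; rewrite natrB // in E2.
rewrite E1 // E2 //.
have a3 : (n%:R + 1) ^+ 2 - j%:R ^+ 2 != 0 :> rat.
  have -> : (n%:R + 1) ^+ 2 - j%:R ^+ 2 = (n%:R + j%:R + 1) * (n%:R - j%:R + 1) :> rat by ring.
  by rewrite mulf_neq0.
move: a1 a2 a3; set c := cbin (n + j); set d := cbin (n - j).
move: c d (n%:R : rat) (j%:R : rat) => c d x y a1 a2 a3.
by field; rewrite a1 a2 a3.
Qed.

(** The two multipliers are chosen to remove [s] from each summand: with a = (n + 1)^2, b = (2n +
    1)^2 / 4 and J = j^2 one has (S^2 - a)(b - J) - (S^2 - b)(a - J) = (b - a)(S^2 - J), so the
    denominator cancels and the telescoping term remains. *)
Lemma xsum_rec n : (n.+1 < s)%N ->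
  (S ^+ 2 - (n%:R + 1) ^+ 2) / 4 * xsum n.+1 - (4 * S ^+ 2 - (2 * n%:R + 1) ^+ 2) * xsum n =
  cbin n ^+ 2 * (8 * n%:R + 2 + (2 * n%:R + 1) ^+ 2 / S ^+ 2).
Proof.
move=> ns.
have n0 : 0 <= n%:R :> rat by exact: ler0n.
have nS : n%:R + 1 < S by rewrite /S natr1 ltr_nat.
have S0 : S != 0 by rewrite gt_eqF //; lra.
have sq j : (j <= n.+1)%N -> S ^+ 2 - j%:R ^+ 2 != 0.
  move=> jn; have j0 : 0 <= j%:R :> rat by exact: ler0n.
  have jS : j%:R < S by rewrite /S ltr_nat; lia.
  by rewrite subr_sqr mulf_neq0 // gt_eqF //; lra.
have sq1 := sq _ (leqnn n.+1); rewrite -natr1 in sq1.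
have n1 : n%:R + 1 != 0 :> rat by rewrite gt_eqF //; lra.
have T : (S ^+ 2 - (n%:R + 1) ^+ 2) / 4 *
     (\sum_(1 <= j < n.+1) 2 * j%:R * cprod n.+1 j / (S ^+ 2 - j%:R ^+ 2))
   - (4 * S ^+ 2 - (2 * n%:R + 1) ^+ 2) *
     (\sum_(1 <= j < n.+1) 2 * j%:R * cprod n j / (S ^+ 2 - j%:R ^+ 2)) =
   - (4 * n%:R + 3) / 2 * (cbin (n + n.+1) - cbin n.+1 * cbin n).
  have -> : cbin (n + n.+1) - cbin n.+1 * cbin n =
     \sum_(1 <= j < n.+1) (cbin (n + j.+1) * cbin (n.+1 - j.+1) - cbin (n + j) * cbin (n.+1 - j)).
    rewrite (telescope_sumr (fun j => cbin (n + j) * cbin (n.+1 - j))) //.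
    by rewrite subnn cbin0 mulr1 addn1 subn1.
  rewrite !big_distrr /= -sumrB; apply: eq_big_nat => j /andP[j1 jn].
  rewrite -cprod_telescope // cprod_succ //.
  have a3 : (n%:R + 1) ^+ 2 - j%:R ^+ 2 != 0 :> rat.
    have jn' : j%:R <= n%:R :> rat by rewrite ler_nat.
    have j0 : 0 <= j%:R :> rat by exact: ler0n.
    by rewrite subr_sqr mulf_neq0 // gt_eqF //; lra.
  have := sq j (ltnW jn); move: a3; set c := cprod n j.
  move: c S (n%:R : rat) (j%:R : rat) => c S' x y a3 a4.
  by field; rewrite a3 a4.
rewrite /xsum big_nat_recr //= -[n.+1%:R]natr1.
(* Needed for the extra summand [j = n.+1] of [xsum n.+1]: it cancels the upper end of the
   telescoping sum, and only multiples of [cbin n ^+ 2] survive. *)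
have L : cprod n.+1 n.+1 * (n%:R + 1) = (4 * n%:R + 3) * cbin (n + n.+1).
  rewrite /cprod subnn cbin0 mulr1 addSn.
  have := cbinS (n + n.+1); rewrite natrD -natr1 => E.
  have h2 : 2 != 0 :> rat by [].
  apply: (mulIf h2).
  transitivity (cbin (n + n.+1).+1 * (n%:R + (n%:R + 1) + 1)); first by ring.
  by rewrite E; ring.
have /(canRL (mulfK n1)) {}L := L.
have /(canRL (mulfK n1)) E := cbinS n.
rewrite L E.
move/(canRL (subrK _)): T; rewrite E.
set A := \sum_(1 <= j < n.+1) _; set B := \sum_(1 <= j < n.+1) _ => T.
transitivity ((S ^+ 2 - (n%:R + 1) ^+ 2) / 4 * A +
  (S ^+ 2 - (n%:R + 1) ^+ 2) / 4 * (- ((n%:R + 1) * (2 * (2 * n%:R + 1) * cbin n / (n%:R + 1)) ^+ 2 / S ^+ 2) +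
     2 * (n%:R + 1) * ((4 * n%:R + 3) * cbin (n + n.+1) / (n%:R + 1)) / (S ^+ 2 - (n%:R + 1) ^+ 2)) -
  (4 * S ^+ 2 - (2 * n%:R + 1) ^+ 2) * (- (n%:R * cbin n ^+ 2 / S ^+ 2) + B)); first by ring.
rewrite T {T}; move: sq1 S0 n1; set c := cbin n; set d := cbin (n + n.+1).
move: c d B S (n%:R : rat) => c d B' S' x a1 a2 a3.
by field; rewrite a1 a2 a3.
Qed.

Definition qcoef (n : nat) : rat := (S - n%:R) * cbin (s - n) / cbin (n + s).

Lemma qcoefS n : (n.+1 < s)%N ->
  qcoef n.+1 * (4 * (4 * S ^+ 2 - (2 * n%:R + 1) ^+ 2)) =
  qcoef n * (S ^+ 2 - (n%:R + 1) ^+ 2).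
Proof.
move=> ns.
have n0 : 0 <= n%:R :> rat by exact: ler0n.
have nS : n%:R + 2 <= S by rewrite /S -natrD ler_nat; lia.
have /(canRL (mulfK _)) E1 := cbinS (n + s).
have /(canRL (mulfK _)) E2 := cbinS (s - n.+1).
have sE : (s - n.+1)%:R = S - n%:R - 1 :> rat by rewrite natrB ?(ltnW ns) // -[n.+1%:R]natr1; ring.
rewrite natrD -/S in E1; rewrite sE subnSK in E2; last by lia.
have a1 : n%:R + S + 1 != 0 by rewrite gt_eqF //; lra.
have a2 : S - n%:R - 1 + 1 != 0 by rewrite gt_eqF //; lra.
have a3 : 2 * (n%:R + S) + 1 != 0 by rewrite gt_eqF //; lra.
have a4 := cbin_neq0 (n + s).
rewrite /qcoef addSn E1 // E2 // -[n.+1%:R]natr1; move: a1 a2 a3 a4.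
set c := cbin (s - n.+1); set d := cbin (n + s).
move: c d S (n%:R : rat) => c d S' x a1 a2 a3 a4.
by field; rewrite a1 a2 a3 a4.
Qed.

(** * Legendre values and norms at the middle point *)

Local Notation P := (2 * s)%N.
Local Notation tau k := (leg P k s).

Lemma leg_mid_rec k : (k < P)%N ->
  (k%:R + 1) * (2 * S - 1 - k%:R) * tau k.+1 =
  - (2 * k%:R + 1) * tau k - k%:R * (2 * S + k%:R) * tau k.-1.
Proof.
move=> kP; have := @leg_rec P k s kP; rewrite natrM -/S natr1 => -> //; last lia.
by ring.
Qed.

(** Each of the two first-order relations is needed to derive the next: the three-term recurrence
    turns the odd relation at [n] into the even one, and both together into the odd relation at
    [n.+1]. *)
Lemma leg_mid_step n : (n < s)%N ->
  tau (2 * n).+1 * (2 * S - 1 - 2 * n%:R) = - (2 * n%:R + 1) * tau (2 * n) /\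
  ((n.+1 < s)%N -> tau (2 * n.+1) * ((n%:R + 1) * (2 * S - 2 * n%:R - 1)) =
     - (2 * n%:R + 1) * (S + n%:R + 1) * tau (2 * n)).
Proof.
move: n; have step n : (n.+1 < s)%N ->
  tau (2 * n).+1 * (2 * S - 1 - 2 * n%:R) = - (2 * n%:R + 1) * tau (2 * n) ->
  tau (2 * n.+1) * ((n%:R + 1) * (2 * S - 2 * n%:R - 1)) =
     - (2 * n%:R + 1) * (S + n%:R + 1) * tau (2 * n).
  move=> ns A; have nS : n%:R + 2 <= S by rewrite /S -natrD ler_nat; lia.
  have := @leg_mid_rec (2 * n).+1; rewrite -[(2 * n).+1.-1]/(2 * n)%N => /(_ ltac:(lia)).
  have -> : ((2 * n).+2 = 2 * n.+1)%N by lia.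
  rewrite -[(2 * n).+1%:R]natr1 natrM.
  set t0 := tau (2 * n) in A *; set t1 := tau (2 * n).+1 in A *; set t2 := tau (2 * n.+1) => E.
  have a0 : 2 * (S - n%:R - 1) != 0 by rewrite gt_eqF //; lra.
  apply: (mulIf a0).
  transitivity ((2 * n%:R + 1 + 1) * (2 * S - 1 - (2 * n%:R + 1)) * t2 *
     (2 * S - 2 * n%:R - 1) / 2); first by field.
  rewrite E.
  transitivity ((- (2 * (2 * n%:R + 1) + 1) * (t1 * (2 * S - 1 - 2 * n%:R)) -
     (2 * n%:R + 1) * (2 * S + (2 * n%:R + 1)) * (2 * S - 2 * n%:R - 1) * t0) / 2); first by field.
  by rewrite A; field.
elim=> [|n IH] ns.
  have A0 : tau (2 * 0).+1 * (2 * S - 1 - 2 * 0%:R) = - (2 * 0%:R + 1) * tau (2 * 0).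
    by have := @leg_mid_rec 0 ltac:(lia); rewrite muln0 => E; rewrite mulrC; move: E; rewrite /=; lra.
  by split=> // n1; apply: step.
have [A B] := IH (ltnW ns); have {}B := B ns.
suff A1 : tau (2 * n.+1).+1 * (2 * S - 1 - 2 * n.+1%:R) = - (2 * n.+1%:R + 1) * tau (2 * n.+1).
  by split=> // n1; apply: step.
have n0 : 0 <= n%:R :> rat by exact: ler0n.
have nS : n%:R + 2 <= S by rewrite /S -natrD ler_nat; lia.
have := @leg_mid_rec (2 * n.+1) ltac:(lia).
have -> : (2 * n.+1).-1 = (2 * n).+1 by lia.
rewrite natrM -[n.+1%:R]natr1.
set t0 := tau (2 * n) in A B *; set t1 := tau (2 * n).+1 in A B *.
set t2 := tau (2 * n.+1) in A B *; set t3 := tau _ => E.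
have a0 : 2 * n%:R + 3 != 0 :> rat by rewrite gt_eqF //; lra.
have a1 : 2 * S - 1 - 2 * n%:R != 0 by rewrite gt_eqF //; lra.
have a2 : S + n%:R + 1 != 0 by rewrite gt_eqF //; lra.
have {A} A : t1 * (S + n%:R + 1) = (n%:R + 1) * t2.
  apply: (mulIf a1); transitivity (t1 * (2 * S - 1 - 2 * n%:R) * (S + n%:R + 1)); first by ring.
  rewrite A; transitivity (- (2 * n%:R + 1) * (S + n%:R + 1) * t0); first by ring.
  by rewrite -B; ring.
apply: (mulIf a0).
transitivity ((2 * (n%:R + 1) + 1) * (2 * S - 1 - 2 * (n%:R + 1)) * t3); first by ring.
rewrite E.
transitivity (- (2 * (2 * (n%:R + 1)) + 1) * t2 - 4 * (n%:R + 1) * (t1 * (S + n%:R + 1))); first by ring.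
by rewrite A; ring.
Qed.

Lemma leg_norm_double n : (n < s)%N ->
  leg_dot P (2 * n).+1 (2 * n).+1 = (4 * n%:R + 1) * (2 * S + 2 * n%:R + 1) *
     leg_dot P (2 * n) (2 * n) / ((2 * S - 1 - 2 * n%:R) * (4 * n%:R + 3)) /\
  ((n.+1 < s)%N -> leg_dot P (2 * n.+1) (2 * n.+1) =
     (4 * n%:R + 3) * (2 * S + 2 * n%:R + 2) * leg_dot P (2 * n).+1 (2 * n).+1 /
     ((2 * S - 2 - 2 * n%:R) * (4 * n%:R + 5))).
Proof.
move=> ns; have n0 : 0 <= n%:R :> rat by exact: ler0n.
have nS : n%:R + 1 <= S by rewrite /S natr1 ler_nat.
split.
  have := @leg_norm_rec P (2 * n) ltac:(lia); rewrite !natrM -/S.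
  set h1 := leg_dot _ _ _; set h0 := leg_dot _ _ _ => E.
  have a : (2 * S - 1 - 2 * n%:R) * (4 * n%:R + 3) != 0.
    by rewrite mulf_neq0 // gt_eqF //; lra.
  apply: (mulIf a); rewrite divfK //.
  transitivity ((2 * S - 1 - 2 * n%:R) * (2 * (2 * n%:R) + 3) * h1); first by ring.
  by rewrite E; ring.
move=> ns1; have nS1 : n%:R + 2 <= S by rewrite /S -natrD ler_nat; lia.
have := @leg_norm_rec P (2 * n).+1 ltac:(lia).
have -> : ((2 * n).+2 = 2 * n.+1)%N by lia.
rewrite -[(2 * n).+1%:R]natr1 !natrM -/S.
set h1 := leg_dot _ _ _; set h0 := leg_dot _ _ _ => E.
have a : (2 * S - 2 - 2 * n%:R) * (4 * n%:R + 5) != 0.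
  by rewrite mulf_neq0 // gt_eqF //; lra.
apply: (mulIf a); rewrite divfK //.
transitivity ((2 * S - 1 - (2 * n%:R + 1)) * (2 * (2 * n%:R + 1) + 3) * h1); first by ring.
by rewrite E; ring.
Qed.

(** Both sides obey the same first-order recurrence in [n]. This removes the squared Legendre values
    from the kernel in favor of [qcoef] and [cbin]. *)
Lemma leg_mid_norm n : (n < s)%N ->
  2 * S ^+ 2 * tau (2 * n) ^+ 2 =
  qcoef n * cbin n ^+ 2 * (leg_dot P (2 * n) (2 * n) * (4 * n%:R + 1)).
Proof.
elim: n => [|n IH] ns.
  rewrite muln0 leg0 leg_dot00 cbin0 /qcoef subn0 natrM -/S.
  by field; exact: cbin_neq0.
have {}IH := IH (ltnW ns).
have n0 : 0 <= n%:R :> rat by exact: ler0n.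
have nS : n%:R + 2 <= S by rewrite /S -natrD ler_nat; lia.
have [_ /(_ ns) B] := leg_mid_step (ltnW ns).
have [H1 /(_ ns) H2] := leg_norm_double (ltnW ns).
have a1 : n%:R + 1 != 0 :> rat by rewrite gt_eqF //; lra.
have a2 : 2 * S - 2 * n%:R - 1 != 0 by rewrite gt_eqF //; lra.
have a3 : 2 * S + 2 * n%:R + 1 != 0 by rewrite gt_eqF //; lra.
have a4 : 4 * n%:R + 3 != 0 :> rat by rewrite gt_eqF //; lra.
have a5 : 4 * n%:R + 5 != 0 :> rat by rewrite gt_eqF //; lra.
have a6 : 2 * S - 2 - 2 * n%:R != 0 by rewrite gt_eqF //; lra.
have a7 : 2 * S - 1 - 2 * n%:R != 0 by rewrite gt_eqF //; lra.
have a8 : 4 * (4 * S ^+ 2 - (2 * n%:R + 1) ^+ 2) != 0.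
  have -> : 4 * S ^+ 2 - (2 * n%:R + 1) ^+ 2 = (2 * S - 2 * n%:R - 1) * (2 * S + 2 * n%:R + 1) by ring.
  by rewrite !mulf_neq0.
have /(canRL (mulfK a8)) Q := qcoefS ns.
have /(canRL (mulfK a1)) E := cbinS n.
have {B} /(canRL (mulfK (mulf_neq0 a1 a2))) B := B.
rewrite B H2 H1 Q E -[n.+1%:R]natr1 {B H1 H2 Q E}.
move: a1 a2 a3 a4 a5 a6 a7 a8 IH.
set t := tau (2 * n); set h := leg_dot _ _ _; set c := cbin n; set q := qcoef n.
move: t h c q S (n%:R : rat) => t h c q S' x a1 a2 a3 a4 a5 a6 a7 a8 IH.
transitivity ((- (2 * x + 1) * (S' + x + 1) / ((x + 1) * (2 * S' - 2 * x - 1))) ^+ 2 *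
   (2 * S' ^+ 2 * t ^+ 2)); first by field; rewrite a1 a2.
move: a8; rewrite mulf_eq0 negb_or => /andP[_ a8].
by rewrite IH; field; rewrite a1 a4 a5 a6 a7 a8.
Qed.

(** By [qcoefS], the increment of [qcoef n * xsum n] is [qcoef n] / (4 S^2 - (2n + 1)^2) times the
    right-hand side of [xsum_rec]; by [leg_mid_norm], the terms of degree 2n and 2n + 1 add up to
    the same. *)
Lemma leg_mid_sum n : (n < s)%N ->
  \sum_(0 <= k < 2 * n) tau k ^+ 2 / leg_dot P k k = qcoef n * xsum n.
Proof.
elim: n => [|n IH] ns.
  by rewrite big_geq // /xsum big_geq // !mul0r oppr0 addr0 mulr0.
have W := leg_mid_norm (ltnW ns).
have n0 : 0 <= n%:R :> rat by exact: ler0n.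
have nS : n%:R + 2 <= S by rewrite /S -natrD ler_nat; lia.
have [A _] := leg_mid_step (ltnW ns).
have [H1 _] := leg_norm_double (ltnW ns).
have h0 : leg_dot P (2 * n) (2 * n) != 0 by rewrite leg_norm_neq0 //; lia.
have a1 : 2 * S - 1 - 2 * n%:R != 0 by rewrite gt_eqF //; lra.
have a2 : 2 * S + 2 * n%:R + 1 != 0 by rewrite gt_eqF //; lra.
have a3 : 4 * n%:R + 3 != 0 :> rat by rewrite gt_eqF //; lra.
have a4 : 4 * n%:R + 1 != 0 :> rat by rewrite gt_eqF //; lra.
have a5 : S != 0 by rewrite gt_eqF //; lra.
have a6 : S ^+ 2 - (n%:R + 1) ^+ 2 != 0.
  by rewrite subr_sqr mulf_neq0 // gt_eqF //; lra.
have a8 : 4 * S ^+ 2 - (2 * n%:R + 1) ^+ 2 != 0.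
  have -> : 4 * S ^+ 2 - (2 * n%:R + 1) ^+ 2 = (2 * S - 1 - 2 * n%:R) * (2 * S + 2 * n%:R + 1) by ring.
  by rewrite !mulf_neq0.
have a9 : 4 * (4 * S ^+ 2 - (2 * n%:R + 1) ^+ 2) != 0 by rewrite mulf_neq0.
have /(canRL (mulfK a9)) Q := qcoefS ns.
have X := xsum_rec ns.
have {A} /(canRL (mulfK a1)) A := A.
have -> : (2 * n.+1 = (2 * n).+2)%N by lia.
rewrite !big_nat_recr //= IH ?(ltnW ns) // A H1 Q {A H1 Q IH}.
move: X W h0 a1 a2 a3 a4 a5 a6 a8.
set X0 := xsum n; set X1 := xsum n.+1; set t := tau (2 * n); set h := leg_dot _ _ _.
set c := cbin n; set q := qcoef n; move: X0 X1 t h c q S (n%:R : rat).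
move=> X0 X1 t h c q S' x X W h0 a1 a2 a3 a4 a5 a6 a8.
have {W} t2 : t ^+ 2 = q * c ^+ 2 * (h * (4 * x + 1)) / (2 * S' ^+ 2).
  by rewrite -W; field.
have {X} -> : X1 = (c ^+ 2 * (8 * x + 2 + (2 * x + 1) ^+ 2 / S' ^+ 2) +
     (4 * S' ^+ 2 - (2 * x + 1) ^+ 2) * X0) * 4 / (S' ^+ 2 - (x + 1) ^+ 2).
  by rewrite -X; field.
rewrite expr_div_n exprMn t2; field.
by rewrite h0 a1 a2 a3 a4 a5 a6 a8.
Qed.
End Sums.

(** * MacMahon's product for the total number of tilings *)

Lemma fact_neq0 n : n`!%:R != 0 :> rat.
Proof. by rewrite pnatr_eq0 -lt0n fact_gt0. Qed.

Lemma leg_normE P j : (j < P)%N ->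
  leg_dot P j j * ((2 * j%:R + 1) * P.-1`!%:R ^+ 2) = (P + j)`!%:R * (P - 1 - j)`!%:R.
Proof.
elim: j => [|j IH] jP.
  case: P jP => // P _; rewrite leg_dot00 addn0 subn0 subn1 /= factS natrM; ring.
have {IH} := IH (ltnW jP); have := leg_norm_rec jP.
have -> : (P - 1 - j = (P - 1 - j.+1).+1)%N by lia.
rewrite addnS !factS !natrM.
have -> : (P - 1 - j.+1).+1%:R = P%:R - 1 - j%:R :> rat.
  by rewrite subnSK ?natrB //; lia.
rewrite -[(P + j).+1%:R]natr1 natrD -[j.+1%:R]natr1.
have j0 : 0 <= j%:R :> rat by exact: ler0n.
have jP' : j%:R + 2 <= P%:R :> rat by rewrite -natrD ler_nat; lia.
have a1 : P%:R - 1 - j%:R != 0 :> rat by rewrite gt_eqF //; lra.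
have a2 : 2 * j%:R + 1 != 0 :> rat by rewrite gt_eqF //; lra.
set h1 := leg_dot P j.+1 j.+1; set h := leg_dot P j j.
set f := P.-1`!%:R; set g := (P + j)`!%:R; set u := (P - 1 - j.+1)`!%:R.
move: h1 h f g u (P%:R : rat) (j%:R : rat) a1 a2 {j0 jP'} => h1 h f g u p x a1 a2 E1 E2.
apply: (mulfI a1); apply: (mulfI a2).
transitivity (((p - 1 - x) * (2 * x + 3) * h1) * (2 * x + 1) * f ^+ 2); first by ring.
rewrite E1.
transitivity ((2 * x + 1) * (p + x + 1) * (h * ((2 * x + 1) * f ^+ 2))); first by ring.
by rewrite E2; ring.
Qed.

Lemma norm_coef_ratio P k : (k < P)%N ->
  leg_dot P k k / leg_coef P k k ^+ 2 =
  (P + k)`!%:R * k`!%:R ^+ 2 / ((P - 1 - k)`!%:R * (2 * k)`!%:R * (2 * k).+1`!%:R).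
Proof.
move=> kP; have := leg_normE kP.
have b1 : 'C(2 * k, k)%:R * k`!%:R ^+ 2 = (2 * k)`!%:R :> rat.
  rewrite -natrX -natrM; have := @bin_fact (2 * k) k ltac:(lia).
  have -> : (2 * k - k = k)%N by lia.
  by rewrite mulnn => <-.
have b2 : 'C(P.-1, k)%:R * (k`!%:R * (P - 1 - k)`!%:R) = P.-1`!%:R :> rat.
  rewrite -!natrM; have := @bin_fact P.-1 k ltac:(lia).
  have -> : (P.-1 - k = P - 1 - k)%N by lia.
  by move=> <-.
have lc : leg_coef P k k ^+ 2 = 'C(2 * k, k)%:R ^+ 2 / 'C(P.-1, k)%:R ^+ 2.
  rewrite /leg_coef /binprod binn mul1r addnn -mul2n.
  by rewrite expr_div_n exprMn sqrr_sign mul1r.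
rewrite lc -b2 factS natrM -b1 -[(2 * k).+1%:R]natr1 natrM.
have c1 : 'C(2 * k, k)%:R != 0 :> rat by rewrite pnatr_eq0 -lt0n bin_gt0; lia.
have c2 : 'C(P.-1, k)%:R != 0 :> rat by rewrite pnatr_eq0 -lt0n bin_gt0; lia.
have k0 : 0 <= k%:R :> rat by exact: ler0n.
have c3 : 2 * k%:R + 1 != 0 :> rat by rewrite gt_eqF //; lra.
have := fact_neq0 k; have := fact_neq0 (P - 1 - k); move: c1 c2 c3.
set h := leg_dot P k k; set c := 'C(2 * k, k)%:R; set d := 'C(P.-1, k)%:R.
set f := k`!%:R; set g := (P - 1 - k)`!%:R; set u := (P + k)`!%:R.
move: h c d f g u (k%:R : rat) {b1 b2 k0} => h c d f g u x c1 c2 c3 g0 f0 E.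
have {E} -> : h = u * g / ((2 * x + 1) * (d * (f * g)) ^+ 2).
  by rewrite -E; field; rewrite c2 c3 f0 g0.
by field; rewrite c1 c2 c3 f0 g0.
Qed.

(** Both sides are the product of all i! with i < 2N, grouped by parity on the left and by halves on
    the right. *)
Lemma prod_fact_double N :
  \prod_(0 <= k < N) ((2 * k)`!%:R * (2 * k).+1`!%:R) =
  \prod_(0 <= i < N) (i`!%:R * (i + N)`!%:R) :> rat.
Proof.
transitivity (\prod_(0 <= i < 2 * N) i`!%:R : rat).
  elim: N => [|N IH]; first by rewrite !big_geq.
  have -> : (2 * N.+1 = (2 * N).+2)%N by lia.
  by rewrite [LHS]big_nat_recr // !big_nat_recr //= IH mulrA.
rewrite (big_cat_nat (n := N)) //=; last by lia.
rewrite big_split /=; congr (_ * _).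
rewrite -{1}[N]add0n big_addn; have -> : (2 * N - N = N)%N by lia.
by [].
Qed.

Lemma prod_ratio_telescope (a : rat) N : 2 <= a ->
  \prod_(1 <= k < N.+1) ((a + k%:R - 1) / (a + k%:R - 2)) = (a + N%:R - 1) / (a - 1).
Proof.
move=> a2; elim: N => [|N IH].
  by rewrite big_geq // addr0 divff // gt_eqF //; lra.
rewrite big_nat_recr //= IH -natr1; have N0 : 0 <= N%:R :> rat by exact: ler0n.
have a1 : a - 1 != 0 by rewrite gt_eqF //; lra.
have a3 : a + (N%:R + 1) - 2 != 0 by rewrite gt_eqF //; lra.
by field; rewrite a1 a3.
Qed.

(** The product over k telescopes, and the product over j then builds up the factorials. *)
Lemma plane_partition_product N M :
  \prod_(1 <= i < N.+1) \prod_(1 <= j < M.+1) \prod_(1 <= k < N.+1)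
     ((i%:R + j%:R + k%:R - 1) / (i%:R + j%:R + k%:R - 2)) =
  \prod_(0 <= i < N) ((i + (N + M))`!%:R * i`!%:R / ((i + N)`!%:R * (i + M)`!%:R)) :> rat.
Proof.
rewrite big_add1 /=; apply: eq_bigr => i _.
transitivity (\prod_(1 <= j < M.+1) ((i + N + j)%:R / (i + j)%:R) : rat).
  apply: eq_big_nat => j /andP[j1 _]; rewrite prod_ratio_telescope; last first.
    by rewrite -natrD (ler_nat _ 2); lia.
  by rewrite !natrD -natr1; congr (_ / _); ring.
elim: M => [|M IH].
  rewrite big_geq // !addn0 divff // mulf_neq0 ?fact_neq0 //.
rewrite big_nat_recr //= IH !addnS !factS !natrM addnA.
have := fact_neq0 (i + N); have := fact_neq0 (i + M).
have a1 : (i + M).+1%:R != 0 :> rat by rewrite pnatr_eq0.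
set u := (i + M).+1%:R in a1 *; set v := (i + N + M).+1%:R.
set a := (i + N)`!%:R; set b := (i + M)`!%:R; set c := (i + N + M)`!%:R; set d := i`!%:R.
by move: u v a b c d a1 => u v a b c d a1 f1 f2; field; rewrite a1 f1 f2.
Qed.

Lemma prod_norm_coef N M :
  \prod_(k < N) (leg_dot (N + M) k k / leg_coef (N + M) k k ^+ 2) =
  \prod_(1 <= i < N.+1) \prod_(1 <= j < M.+1) \prod_(1 <= k < N.+1)
     ((i%:R + j%:R + k%:R - 1) / (i%:R + j%:R + k%:R - 2)).
Proof.
rewrite plane_partition_product -(big_mkord xpredT (fun k => leg_dot (N + M) k k / leg_coef (N + M) k k ^+ 2)).
transitivity (\prod_(0 <= k < N) (((k + (N + M))`!%:R * (k`!%:R * k`!%:R)) /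
   ((N + M - 1 - k)`!%:R * ((2 * k)`!%:R * (2 * k).+1`!%:R))) : rat).
  apply: eq_big_nat => k /andP[_ kN]; rewrite norm_coef_ratio; last by lia.
  by rewrite [(N + M + k)%N]addnC expr2 -[_ * _ * (2 * k).+1`!%:R]mulrA.
have p0 (F : nat -> nat) : \prod_(0 <= k < N) (F k)`!%:R != 0 :> rat.
  by rewrite prodf_seq_neq0; apply/allP => k _; rewrite fact_neq0.
have := p0 (fun k => (2 * k)%N); have := p0 (fun k => (2 * k).+1).
have := p0 (fun k => k); have := p0 (fun k => (k + N)%N); have := p0 (fun k => (k + M)%N).
have := prod_fact_double N; rewrite !prodf_div !big_split /=.
(* Reversing the order of the factors. *)
have -> : \prod_(0 <= k < N) (N + M - 1 - k)`!%:R = \prod_(0 <= k < N) (k + M)`!%:R :> rat.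
  rewrite big_nat_rev /=; apply: eq_big_nat => i /andP[_ iN].
  by congr (_`!%:R); lia.
move: (\prod_(0 <= k < N) (2 * k)`!%:R) (\prod_(0 <= k < N) (2 * k).+1`!%:R) => a b.
move: (\prod_(0 <= k < N) k`!%:R) (\prod_(0 <= k < N) (k + N)`!%:R) => c d.
move: (\prod_(0 <= k < N) (k + M)`!%:R) => u.
move: (\prod_(0 <= k < N) _) => v E u0 d0 c0 b0 a0.
by rewrite E; field; rewrite u0 d0 c0.
Qed.

(** At [h = 0] the prefactor is exactly the summand [j = 1] of [xsum] divided by [x * cbin n ^+ 2];
    afterwards both sides have the same ratio of consecutive terms. *)
Lemma hypergeometric_term (n s h : nat) : (h < n < s)%N ->
  let x : rat := n%:R in let t : rat := s%:R in
  (4 * x + 2) / ((x + 1) * (2 * x - 1) * (t - 1) * (t + 1)) *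
  ((shifted_factorial 2 h * shifted_factorial (1 - x) h
              * shifted_factorial (3 / 2 + x) h
              * shifted_factorial (1 - t) h
              * shifted_factorial (1 + t) h)
             / (shifted_factorial 1 h * shifted_factorial (2 + x) h
                * shifted_factorial (3 / 2 - x) h
                * shifted_factorial (2 + t) h
                * shifted_factorial (2 - t) h)) =
  2 * (h%:R + 1) * cprod n h.+1 / (t ^+ 2 - (h%:R + 1) ^+ 2) / (x * cbin n ^+ 2).
Proof.
move=> hns x t.
have sfS a k : shifted_factorial a k.+1 = shifted_factorial a k * (a + k%:R).
  by rewrite /shifted_factorial big_ord_recr.
have cn := cbin_neq0 n.
elim: h hns => [|h IH] /andP[hn ns].
  have x1 : 1 <= x by rewrite (ler_nat _ 1).
  have xt : x + 1 <= t by rewrite /x natr1 ler_nat.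
  rewrite /shifted_factorial !big_ord0 /cprod addn1 subn1.
  have a1 : x + 1 != 0 by rewrite gt_eqF //; lra.
  have a2 : x != 0 by rewrite gt_eqF //; lra.
  have a3 : 2 * x - 1 != 0 by rewrite gt_eqF //; lra.
  have a4 : t - 1 != 0 by rewrite gt_eqF //; lra.
  have a5 : t + 1 != 0 by rewrite gt_eqF //; lra.
  have := cbinS n; rewrite -/x => /(canRL (mulfK a1)) ->.
  have := cbinS n.-1; rewrite prednK //.
  have -> : n.-1%:R = x - 1 :> rat by rewrite -subn1 natrB.
  have := cbin_neq0 n.-1; set u := cbin n.-1; set c := cbin n; rewrite subrK => u0.
  move/(canRL (mulfK a2)) => ->; rewrite add0r.
  rewrite (_ : t ^+ 2 - 1 ^+ 2 = (t - 1) * (t + 1)); last by rewrite subr_sqr.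
  have a6 : 2 * (x - 1) + 1 != 0 by rewrite gt_eqF //; lra.
  by clearbody x t u; field; rewrite a1 a2 a4 a5 a6 u0.
have h0 : 0 <= h%:R :> rat by exact: ler0n.
have hx : h%:R + 2 <= x by rewrite /x -natrD ler_nat; lia.
have xt : x + 1 <= t by rewrite /x natr1 ler_nat.
rewrite !sfS.
set g := (4 * x + 2) / _ in IH *.
set n1 := shifted_factorial 2 h in IH *; set d1 := shifted_factorial 1 h in IH *.
set n2 := shifted_factorial (1 - x) h in IH *; set d2 := shifted_factorial (2 + x) h in IH *.
set n3 := shifted_factorial (3 / 2 + x) h in IH *; set d3 := shifted_factorial (3 / 2 - x) h in IH *.
set n4 := shifted_factorial (1 - t) h in IH *; set d4 := shifted_factorial (2 + t) h in IH *.
set n5 := shifted_factorial (1 + t) h in IH *; set d5 := shifted_factorial (2 - t) h in IH *.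
transitivity ((g * ((n1 * n2 * n3 * n4 * n5) / (d1 * d2 * d3 * d4 * d5))) *
  (((2 + h%:R) * (1 - x + h%:R) * (3 / 2 + x + h%:R) * (1 - t + h%:R) * (1 + t + h%:R)) /
   ((1 + h%:R) * (2 + x + h%:R) * (3 / 2 - x + h%:R) * (2 + t + h%:R) * (2 - t + h%:R)))).
  rewrite -[RHS]mulrA; congr (g * _).
  rewrite -!/(_ * _ / _) mulf_div; congr (_ / _); ring.
rewrite IH; last by lia.
move: cn; rewrite /cprod !addnS -[h.+1%:R]natr1.
have := cbinS (n + h).+1; have := cbinS (n - h.+2).
rewrite subnSK // -[(n + h).+1%:R]natr1 natrD -/x natrB // -/x.
have -> : h.+2%:R = h%:R + 2 :> rat by rewrite -addn2 natrD.
set c := cbin (n + h).+1; set c' := cbin (n + h).+2; set d := cbin (n - h.+1); set d' := cbin (n - h.+2).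
set b := cbin n.
have a1 : x - (h%:R + 2) + 1 != 0 by rewrite gt_eqF //; lra.
have a2 : x + h%:R + 1 + 1 != 0 by rewrite gt_eqF //; lra.
move=> /(canRL (mulfK a1)) -> /(canRL (mulfK a2)) -> b0.
have x0 : x != 0 by rewrite gt_eqF //; lra.
have a3 : 1 + h%:R != 0 :> rat by rewrite gt_eqF //; lra.
have a4 : 2 + x + h%:R != 0 by rewrite gt_eqF //; lra.
have a5 : 3 / 2 - x + h%:R != 0 by rewrite lt_eqF //; lra.
have a6 : 2 + t + h%:R != 0 by rewrite gt_eqF //; lra.
have a7 : 2 - t + h%:R != 0 by rewrite lt_eqF //; lra.
have a8 : t ^+ 2 - (h%:R + 1) ^+ 2 != 0 by rewrite subr_sqr mulf_neq0 // gt_eqF //; lra.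
have a9 : t ^+ 2 - (h%:R + 1 + 1) ^+ 2 != 0 by rewrite subr_sqr mulf_neq0 // gt_eqF //; lra.
(* Twice the factor in [a5]: [field] clears the fraction 3/2 before asking for it to be nonzero. *)
have a10 : 3 - 2 * x + 2 * h%:R != 0 by rewrite lt_eqF //; lra.
move: c d' b x t (h%:R : rat) b0 x0 a1 a2 a3 a4 a5 a6 a7 a8 a9 a10 {h0 hx xt IH g n1 n2 n3 n4 n5 d1 d2 d3 d4 d5}.
move=> p q r x' t' y b0 x0 a1 a2 a3 a4 a5 a6 a7 a8 a9 a10.
have {}a10 : 3 + - x' * 2 + y * 2 != 0.
  by rewrite (_ : 3 + - x' * 2 + y * 2 = 3 - 2 * x' + 2 * y) //; ring.
by field; rewrite b0 x0 a9 a2 a7 a6 a10 a3 a8 a1.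
Qed.

Theorem theorem1 (n m : nat) (hn : (0 < n)%N) (hm : (0 < m)%N) :
  let x : rat := n%:R in
  let y : rat := m%:R in
  (num_tilings_with_axis_rhombus (2 * n)%N (2 * m)%N (n + m)%N)%:R =
    x * y * 'C(2 * n, n)%:R * 'C(2 * n - 1, n)%:R * 'C(2 * m, m)%:R
      / 'C(4 * n + 2 * m - 1, 2 * n + m)%:R
    * (- (1 / (x + y) ^+ 2)
       + (4 * x + 2) / ((x + 1) * (2 * x - 1) * (x + y - 1) * (x + y + 1))
         * \sum_(0 <= h < n)
             (shifted_factorial 2 h * shifted_factorial (1 - x) h
              * shifted_factorial (3 / 2 + x) h
              * shifted_factorial (1 - x - y) h
              * shifted_factorial (1 + x + y) h)
             / (shifted_factorial 1 h * shifted_factorial (2 + x) h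
                * shifted_factorial (3 / 2 - x) h
                * shifted_factorial (2 + x + y) h
                * shifted_factorial (2 - x - y) h))
    * \prod_(1 <= i < (2 * n).+1) \prod_(1 <= j < (2 * m).+1)
        \prod_(1 <= k < (2 * n).+1)
          ((i%:R + j%:R + k%:R - 1) / (i%:R + j%:R + k%:R - 2)) :> rat.
Proof.
move=> x y.
have hl : (n + m < 2 * n + 2 * m)%N by lia.
have n20 : (0 < 2 * n)%N by lia.
have s0 : (0 < n + m)%N by lia.
have ns : (n < n + m)%N by lia.
rewrite (num_tilings_kernel (Ordinal hl) n20) prod_norm_coef mulrC; congr (_ * _).
rewrite -(big_mkord xpredT (fun k => leg (2 * n + 2 * m) k (n + m) ^+ 2 /
  leg_dot (2 * n + 2 * m) k k)) -mulnDr leg_mid_sum //.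
set t : rat := (n + m)%:R.
have tE : t = x + y by rewrite /t natrD.
rewrite -!(addrA _ x y) -!(addrA _ (- x) (- y)) -opprD -tE.
have -> : (4 * x + 2) / ((x + 1) * (2 * x - 1) * (t - 1) * (t + 1)) *
    \sum_(0 <= h < n)
             (shifted_factorial 2 h * shifted_factorial (1 - x) h
              * shifted_factorial (3 / 2 + x) h
              * shifted_factorial (1 - t) h
              * shifted_factorial (1 + t) h)
             / (shifted_factorial 1 h * shifted_factorial (2 + x) h
                * shifted_factorial (3 / 2 - x) h
                * shifted_factorial (2 + t) h
                * shifted_factorial (2 - t) h) =
    (\sum_(1 <= j < n.+1) 2 * j%:R * cprod n j / (t ^+ 2 - j%:R ^+ 2)) / (x * cbin n ^+ 2).
  rewrite big_add1 /= big_distrl big_distrr /=; apply: eq_big_nat => h /andP[_ hn'].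
  by rewrite hypergeometric_term ?hn' ?ns // -[h.+1%:R]natr1.
rewrite /xsum /qcoef -/t addKn.
have -> : (n + (n + m) = 2 * n + m)%N by lia.
(* The coefficients with an odd upper index in the statement are halves of central ones; the two
   factors 2, one above and one below the fraction bar, cancel. *)
have := @cbin_pred n hn; have := @cbin_pred (2 * n + m) ltac:(lia).
have -> : (2 * (2 * n + m) - 1 = 4 * n + 2 * m - 1)%N by lia.
rewrite -/(cbin n) -/(cbin m) -/x => E1 E2.
have x0 : x != 0 by rewrite pnatr_eq0; lia.
have t0 : t != 0 by rewrite pnatr_eq0; lia.
have := cbin_neq0 n; have := cbin_neq0 (2 * n + m); rewrite E1 E2.
set c := 'C(2 * n - 1, n)%:R; set d := 'C(4 * n + 2 * m - 1, 2 * n + m)%:R.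
set T := \sum_(1 <= j < n.+1) _; rewrite tE in t0 *.
move: (cbin m) c d T x y x0 t0 {E1 E2 tE} => p c d T x' y' x0 t0 d0 c0.
have {}d0 : d != 0 by move: d0; rewrite mulf_eq0 negb_or => /andP[].
have {}c0 : c != 0 by move: c0; rewrite mulf_eq0 negb_or => /andP[].
by field; rewrite x0 t0 c0 d0.
Qed.
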